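(* Let $\gamma$ be a smooth strictly convex closed plane curve, and let $R$ be greater than the greatest curvature radius of $\gamma$. Let $N_{p,q}$ be the minimal area of a circumscribed curvilinear $q$-gon with rotation number $p$, whose sides are circular arcs of radius $R$. Then for all relatively prime positive integers $p,q$ with $0<\frac pq<1$, $$N_{p,q-1}+N_{p,q+1}>2N_{p,q}.$$
   Context: The greatest curvature radius is understood to be finite, so $\gamma$ has positive curvature. Orient $\gamma$ counterclockwise and for $\theta\in\mathbb{R}$ let $\gamma(\theta)$ be the point of $\gamma$ with oriented tangent direction $(\cos\theta,\sin\theta)$. Let $C_\theta$ be the counterclockwise oriented circle of radius $R$ tangent to $\gamma$ at $\gamma(\theta)$ with agreeing orientation, i.e. with center $\gamma(\theta)+R(-\sin\theta,\cos\theta)$; the curve $\gamma$ lies inside $C_\theta$. For $\theta<\theta'<\theta+2\pi$ the circles $C_\theta$ and $C_{\theta'}$ meet in two points; let $A(\theta,\theta')$ be the first point of $C_{\theta'}$ encountered when traversing $C_\theta$ counterclockwise starting from $\gamma(\theta)$. By continuity, $A(\theta,\theta)=\gamma(\theta)$ and $A(\theta,\theta+2\pi)$ is the point of $C_\theta$ antipodal to $\gamma(\theta)$. A circumscribed curvilinear $q$-gon with rotation number $p$ is given by real numbers $\theta_0\le\theta_1\le\dots\le\theta_q=\theta_0+2\pi p$ with $0\le\theta_{i+1}-\theta_i\le2\pi$, extended by $\theta_{i+q}=\theta_i+2\pi p$; its vertices are $A_i=A(\theta_i,\theta_{i+1})$ and its $i$-th side is the counterclockwise arc of $C_{\theta_i}$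 from $A_{i-1}$ through $\gamma(\theta_i)$ to $A_i$ (for $p=q=1$ this is a full circle $C_{\theta_0}$). Its area is the algebraic area $\frac12\oint(u\,dv-v\,du)$ of the resulting closed oriented curve in Cartesian coordinates $(u,v)$ (area counted with winding numbers). The integers $p\le q$ in the definition of $N_{p,q}$ need not be relatively prime. *)

(* Defs.v *)
From Stdlib Require Import Reals ClassicalEpsilon.
From Coquelicot Require Import Coquelicot.
Open Scope R_scope.

Definition plane : Type := (R * R)%type.

(** * The curve *)

Definition xcoord (c : R -> plane) (t : R) : R := fst (c t).
Definition ycoord (c : R -> plane) (t : R) : R := snd (c t).

Definition speed (c : R -> plane) (t : R) : R :=
  sqrt (Derive (xcoord c) t ^ 2 + Derive (ycoord c) t ^ 2).

(** Signed curvature: positive where the curve turns left. *)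
Definition curvature (c : R -> plane) (t : R) : R :=
  (Derive (xcoord c) t * Derive_n (ycoord c) 2 t
   - Derive (ycoord c) t * Derive_n (xcoord c) 2 t) / speed c t ^ 3.

Definition curvature_radius (c : R -> plane) (t : R) : R := / curvature c t.

Definition smooth (c : R -> plane) : Prop :=
  forall (n : nat) (t : R), ex_derive_n (xcoord c) n t /\ ex_derive_n (ycoord c) n t.

Definition regular (c : R -> plane) : Prop := forall t : R, 0 < speed c t.

Definition simple_closed (c : R -> plane) (T : R) : Prop :=
  0 < T /\
  (forall t : R, c (t + T) = c t) /\
  (forall s t : R, 0 <= s -> s < t -> t < T -> c s <> c t).

(** Each tangent line meets the curve only at its point of tangency, and the
    rest of the curve lies to the left of the oriented tangent line.  The choice
    of the left side also says that the orientation is counterclockwise. *)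
Definition strictly_convex_ccw (c : R -> plane) : Prop :=
  forall s t : R, c s <> c t ->
    0 < Derive (xcoord c) t * (ycoord c s - ycoord c t)
        - Derive (ycoord c) t * (xcoord c s - xcoord c t).

Definition positively_curved (c : R -> plane) : Prop :=
  forall t : R, 0 < curvature c t.

(** A smooth strictly convex closed curve of finite curvature radius, given by
    a regular counterclockwise parametrization of period [T]. *)
Definition convex_curve (c : R -> plane) (T : R) : Prop :=
  smooth c /\ regular c /\ simple_closed c T /\
  strictly_convex_ccw c /\ positively_curved c.

Definition has_tangent_direction (c : R -> plane) (theta : R) (P : plane) : Prop :=
  exists t : R, P = c t /\
    Derive (xcoord c) t = speed c t * cos theta /\
    Derive (ycoord c) t = speed c t * sin theta.

(** The point of the curve with oriented tangent direction
    [(cos theta, sin theta)]; it exists and is unique for a [convex_curve]. *)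
Definition gamma (c : R -> plane) (theta : R) : plane :=
  epsilon (inhabits (0, 0)) (has_tangent_direction c theta).

(** * The circles of radius [r] tangent to the curve *)

Definition center (c : R -> plane) (r theta : R) : plane :=
  (fst (gamma c theta) - r * sin theta, snd (gamma c theta) + r * cos theta).

(** The point of the circle reached from [gamma c theta] by turning
    counterclockwise through the angle [s]: at [s = 0] it is [gamma c theta],
    and at [s = PI] the antipode of [gamma c theta]. *)
Definition circle_point (c : R -> plane) (r theta s : R) : plane :=
  (fst (center c r theta) + r * sin (theta + s),
   snd (center c r theta) - r * cos (theta + s)).

Definition on_circle (c : R -> plane) (r theta : R) (P : plane) : Prop :=
  (fst P - fst (center c r theta)) ^ 2 + (snd P - snd (center c r theta)) ^ 2 = r ^ 2.

(** [P] is the first point of the circle at [theta'] met when traversing the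
    circle at [theta] counterclockwise starting from [gamma c theta]. *)
Definition first_hit (c : R -> plane) (r theta theta' : R) (P : plane) : Prop :=
  exists s : R, 0 <= s /\
    P = circle_point c r theta s /\ on_circle c r theta' P /\
    (forall s' : R, 0 <= s' < s -> ~ on_circle c r theta' (circle_point c r theta s')).

(** The first two cases are the continuous extension to the values of
    [theta'] for which the two circles coincide. *)
Definition is_vertex (c : R -> plane) (r theta theta' : R) (P : plane) : Prop :=
  (theta' = theta /\ P = gamma c theta) \/
  (theta' = theta + 2 * PI /\ P = circle_point c r theta PI) \/
  (theta < theta' < theta + 2 * PI /\ first_hit c r theta theta' P).

Definition vertex (c : R -> plane) (r theta theta' : R) : plane :=
  epsilon (inhabits (0, 0)) (is_vertex c r theta theta').

(** * Circumscribed curvilinear polygons *)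

(** [th] lists the tangent directions at the points where the sides touch the
    curve, extended to all indices by [th (i + q) = th i + 2 * PI * p]. *)
Definition circumscribed (p q : nat) (th : nat -> R) : Prop :=
  (forall i : nat, th (i + q)%nat = th i + 2 * PI * INR p) /\
  (forall i : nat, 0 <= th (S i) - th i <= 2 * PI).

(** The counterclockwise arc of the circle at [theta] from [P] through
    [gamma c theta] to [Q] is the image of [[fst ab, snd ab]] under
    [circle_point c r theta]. *)
Definition is_arc (c : R -> plane) (r theta : R) (P Q : plane) (ab : R * R) : Prop :=
  - (2 * PI) < fst ab <= 0 /\ 0 <= snd ab < 2 * PI /\
  circle_point c r theta (fst ab) = P /\ circle_point c r theta (snd ab) = Q.

(** The polygon with touching directions [th] has the vertices
    [vertex c r (th i) (th (S i))]; side [i], for [i >= 1], joins the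
    vertices with indices [i - 1] and [i]. *)
Definition side (c : R -> plane) (r : R) (th : nat -> R) (i : nat) : R * R :=
  epsilon (inhabits (0, 0))
    (is_arc c r (th i) (vertex c r (th (pred i)) (th i))
                       (vertex c r (th i) (th (S i)))).

(** One half of the integral of [u dv - v du] along the path [f] on [[a, b]]. *)
Definition area_integral (f : R -> plane) (a b : R) : R :=
  / 2 * RInt (fun t => xcoord f t * Derive (ycoord f) t
                       - ycoord f t * Derive (xcoord f) t) a b.

(** Algebraic area of the closed curve formed by sides [1, ..., q]. *)
Definition polygon_area (c : R -> plane) (r : R) (q : nat) (th : nat -> R) : R :=
  sum_n_m (fun i : nat =>
    area_integral (circle_point c r (th i))
      (fst (side c r th i)) (snd (side c r th i))) 1 q.

Definition is_minimal_area (c : R -> plane) (r : R) (p q : nat) (a : R) : Prop :=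
  (exists th : nat -> R, circumscribed p q th /\ polygon_area c r q th = a) /\
  (forall th : nat -> R, circumscribed p q th -> a <= polygon_area c r q th).

(* Main.v *)
Require Import Defs.
From Stdlib Require Import Reals Lra Lia ZArith Psatz ClassicalEpsilon Classical IndefiniteDescription.
From Coquelicot Require Import Coquelicot.
Open Scope R_scope.

(** Let [O(t)] be the center of the circle at [t]. Then [O' = - (r - rho) (cos, sin)],
    so the centers trace a convex curve, and, up to the constant [PI r^2 p], the area
    of a polygon is a sum of terms [K(th_i, th_{i+1})] with
    [K(x, y) = det(O(x), O(y)) / 2 - r^2 (d + sin d cos d)] and [|O(x) - O(y)| = 2 r sin d].
    If [a] and [b] are the angles turned from [gamma(x)] forward and from [gamma(y)]
    backward to the vertex, then [dK/dx] and [dK/dy] are [(r - rho(x)) r cos a] and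
    [- (r - rho(y)) r cos b] up to terms in [x] alone and in [y] alone. As [x] increases,
    [b] decreases strictly, so [K] satisfies a strict Monge (twist) inequality:
    exchanging crossing steps of two sequences lowers the sum of [K].

    Take a minimal [(q-1)]-gon [x] and a minimal [(q+1)]-gon [y] with
    [y_0 <= x_0 < y_1]. The sequences [x_i] and [y_{i+1}] cross; replacing them by their
    minimum and maximum lowers the sum of [K] strictly. Extended by [y_0] and [y_{q+1}],
    the two new sequences both make [q] steps, one from [y_0] to [x_0 + 2 PI p] and the
    other from [x_0] to [y_0 + 2 PI p]; a second exchange closes them into two [q]-gons. *)

(** * Preliminaries on real functions *)

(** [K] plays the role of the generating function of a twist map, and the exchange is the one of
    Aubry-Mather theory. Two obstacles shape the proof. Two sequences may change order by touching
    at a common value, where minimum and maximum merely recombine the same steps and gain nothing.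
    The gain then comes from a corner: the recombined sequence reaches the common point along one
    sequence and leaves along the other. Since the point is optimal between its neighbours in the
    second sequence, the strict dependence of [dK/dy] on [x] shows that it is not optimal at the
    corner. The other obstacle is the boundary of the admissible steps. For a step 0 or [2 PI] the
    centers coincide and their distance is not differentiable. No derivative is taken there: the
    Monge inequality extends to such steps by continuity, and since [K] vanishes on them, its
    degenerate cases replace the derivative arguments. *)

Lemma two_PI_translate (l x : R) : exists k : Z, l <= x + 2 * PI * IZR k < l + 2 * PI.
Proof.
  assert (HPI := PI_RGT_0).
  set (z := (l - x) / (2 * PI)).
  exists (1 - up (- z))%Z. rewrite minus_IZR.
  destruct (archimed (- z)) as [h1 h2].
  set (k := IZR (up (- z))) in *.
  assert (E : l - x = 2 * PI * z) by (unfold z; field; lra).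
  split; nra.
Qed.

Lemma periodic_Z (f : R -> R) :
  (forall x, f (x + 2 * PI) = f x) -> forall (k : Z) (x : R), f (x + 2 * PI * IZR k) = f x.
Proof.
  intros Hf.
  assert (Hn : forall (n : nat) x, f (x + 2 * PI * INR n) = f x).
  { induction n as [|n IH]; intros x.
    - simpl. f_equal. ring.
    - rewrite S_INR.
      replace (x + 2 * PI * (INR n + 1)) with ((x + 2 * PI * INR n) + 2 * PI) by ring.
      rewrite Hf. apply IH. }
  intros k x. destruct (Z_le_gt_dec 0 k) as [h|h].
  - rewrite <- (Z2Nat.id k) by lia. rewrite <- INR_IZR_INZ. apply Hn.
  - rewrite <- (Hn (Z.to_nat (- k)) (x + 2 * PI * IZR k)). f_equal.
    rewrite INR_IZR_INZ, Z2Nat.id by lia. rewrite opp_IZR. ring.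
Qed.

Lemma cos_translate (k : Z) (x : R) : cos (x + 2 * PI * IZR k) = cos x.
Proof. apply (periodic_Z cos). intros y. rewrite cos_plus, cos_2PI, sin_2PI. ring. Qed.

Lemma sin_translate (k : Z) (x : R) : sin (x + 2 * PI * IZR k) = sin x.
Proof. apply (periodic_Z sin). intros y. rewrite sin_plus, cos_2PI, sin_2PI. ring. Qed.

Lemma sin2_cos2_pow (x : R) : sin x ^ 2 + cos x ^ 2 = 1.
Proof. rewrite <- (sin2_cos2 x). unfold Rsqr. ring. Qed.

Lemma polar_coordinates (l u v : R) :
  exists L phi, 0 <= L /\ l <= phi < l + 2 * PI /\ u = L * cos phi /\ v = L * sin phi.
Proof.
  assert (HPI := PI_RGT_0).
  enough (H : exists L phi, 0 <= L /\ u = L * cos phi /\ v = L * sin phi).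
  { destruct H as (L & phi & HL & Hu & Hv).
    destruct (two_PI_translate l phi) as (k & Hk).
    exists L, (phi + 2 * PI * IZR k). rewrite cos_translate, sin_translate. tauto. }
  set (L := sqrt (u ^ 2 + v ^ 2)).
  assert (HL2 : L ^ 2 = u ^ 2 + v ^ 2) by (apply pow2_sqrt; nra).
  assert (HL : 0 <= L) by apply sqrt_pos.
  destruct (Req_dec L 0) as [E|E].
  - exists 0, 0. rewrite E in HL2. assert (u = 0 /\ v = 0) by nra. split; [lra|]. nra.
  - set (z := u / L).
    assert (Hz : u = L * z) by (unfold z; field; assumption).
    assert (Hz1 : z ^ 2 + (v / L) ^ 2 = 1).
    { unfold z. field_simplify; [|lra]. rewrite HL2. field. nra. }
    assert (Hv : v = L * (v / L)) by (field; assumption).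
    set (y := v / L) in *.
    assert (Hzb : -1 <= z <= 1) by nra.
    assert (Hc := cos_acos z Hzb). assert (Hs := sin_acos z Hzb).
    assert (Hs2 : 0 <= sin (acos z)).
    { destruct (acos_bound z). apply sin_ge_0; lra. }
    assert (Hq := sin2_cos2_pow (acos z)). rewrite Hc in Hq.
    destruct (Rle_dec 0 y) as [hy|hy].
    + exists L, (acos z). rewrite Hc. repeat split; [lra|lra|].
      rewrite Hv. f_equal. nra.
    + exists L, (- acos z). rewrite cos_neg, sin_neg, Hc. repeat split; [lra|lra|].
      rewrite Hv. f_equal. nra.
Qed.

Lemma continuity_pt_of_is_derive (f : R -> R) (x l : R) : is_derive f x l -> continuity_pt f x.
Proof.
  intros H. apply derivable_continuous_pt. exists l. apply is_derive_Reals. exact H.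
Qed.

Lemma is_derive_pos_increasing (f df : R -> R) (a b : R) :
  a < b -> (forall x, a <= x <= b -> continuity_pt f x) ->
  (forall x, a < x < b -> is_derive f x (df x)) ->
  (forall x, a < x < b -> 0 < df x) -> f a < f b.
Proof.
  intros Hab Hc Hd Hp.
  assert (pr : forall c, a < c < b -> derivable_pt f c).
  { intros c Hcc. exists (df c). apply is_derive_Reals. auto. }
  assert (pr2 : forall c, a < c < b -> derivable_pt id c).
  { intros. apply derivable_pt_id. }
  destruct (MVT f id a b pr pr2 Hab Hc) as (c & P & E).
  { intros. apply derivable_continuous_pt, derivable_pt_id. }
  assert (E1 : derive_pt f c (pr c P) = df c).
  { apply derive_pt_eq_0, is_derive_Reals. auto. }
  assert (E2 : derive_pt id c (pr2 c P) = 1).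
  { apply derive_pt_eq_0, derivable_pt_lim_id. }
  rewrite E1, E2 in E. unfold id in E. specialize (Hp c P). nra.
Qed.

Lemma is_derive_pos_local (f : R -> R) (x l : R) :
  is_derive f x l -> 0 < l ->
  exists eta, 0 < eta /\ forall h, 0 < h < eta -> f x < f (x + h) /\ f (x - h) < f x.
Proof.
  intros Hd Hl. apply is_derive_Reals in Hd.
  destruct (Hd l Hl) as (eta & He).
  exists eta. split; [apply cond_pos|]. intros h Hh. split.
  - assert (H := He h ltac:(lra)). rewrite Rabs_pos_eq in H by lra.
    specialize (H (proj2 Hh)). apply Rabs_def2 in H.
    assert (E : f (x + h) - f x = h * ((f (x + h) - f x) / h)) by (field; lra).
    nra.
  - assert (H := He (- h) ltac:(lra)). rewrite Rabs_Ropp, Rabs_pos_eq in H by lra.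
    specialize (H (proj2 Hh)). apply Rabs_def2 in H.
    replace (x + - h) with (x - h) in H by ring.
    assert (E : f x - f (x - h) = h * ((f (x - h) - f x) / - h)) by (field; lra).
    nra.
Qed.

Lemma continuity_pt_pos_local (f : R -> R) (x : R) :
  continuity_pt f x -> 0 < f x ->
  exists eta, 0 < eta /\ forall z, Rabs (z - x) < eta -> 0 < f z.
Proof.
  intros Hc Hp. destruct (Hc (f x) Hp) as (eta & He & H).
  exists eta. split; [exact He|]. intros z Hz.
  destruct (Req_dec z x) as [->|Hn]; [exact Hp|].
  assert (A : Rabs (f z - f x) < f x).
  { apply H. repeat split; auto. }
  apply Rabs_def2 in A. lra.
Qed.

(** Every zero of [f] is an upward crossing, so [f] cannot return to 0 once it is positive. The
    supremum of the initial intervals of positivity can neither lie before [b] nor be a zero. The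
    sign of the derivative is asked for at zeros only, which is where [chord_angle_decreasing] can
    compute it. *)
Lemma pos_after_zero (f df : R -> R) (a b : R) :
  a < b -> (forall x, a <= x <= b -> is_derive f x (df x)) ->
  f a = 0 -> (forall x, a <= x <= b -> f x = 0 -> 0 < df x) -> 0 < f b.
Proof.
  intros Hab Hd Hfa Hz.
  set (E := fun s => a <= s <= b /\ forall t, a < t < s -> 0 < f t).
  assert (HEa : E a) by (split; [lra|intros; lra]).
  destruct (completeness E) as (s & Hub & Hlub).
  { exists b. intros x (Hx & _). lra. }
  { exists a. exact HEa. }
  assert (Has : a <= s) by (apply Hub; exact HEa).
  assert (Hsb : s <= b) by (apply Hlub; intros x (Hx & _); lra).
  assert (Hpos : forall t, a < t < s -> 0 < f t).
  { intros t Ht. apply NNPP. intros Hn. apply (Rlt_not_le s t); [lra|].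
    apply Hlub. intros x (Hx & Hx2). apply Rnot_lt_le. intros Htx. apply Hn, Hx2. lra. }
  assert (Hext : forall e, 0 < e -> (forall h, 0 < h < e -> 0 < f (s + h)) ->
                  (a < s -> 0 < f s) -> s < b -> False).
  { intros e He Hh Hs Hb.
    set (m := Rmin e (b - s) / 2).
    assert (Hm : 0 < m /\ m < e /\ m < b - s).
    { unfold m, Rmin. destruct Rle_dec; lra. }
    apply (Rlt_not_le (s + m) s); [lra|]. apply Hub. split; [lra|].
    intros t Ht. destruct (Rtotal_order t s) as [h|[h|h]].
    - apply Hpos; lra.
    - subst t. apply Hs; lra.
    - replace t with (s + (t - s)) by ring. apply Hh. lra. }
  destruct (Req_dec (f s) 0) as [E0|E0].
  - destruct (is_derive_pos_local f s (df s)) as (eta & He & Hloc); [apply Hd; lra|apply Hz; lra|].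
    destruct (Req_dec s a) as [->|Hsa].
    + exfalso. apply (Hext eta He); try lra.
      intros h Hh. destruct (Hloc h Hh). lra.
    + set (h := Rmin eta (s - a) / 2).
      assert (Hm : 0 < h /\ h < eta /\ h < s - a).
      { unfold h, Rmin. destruct Rle_dec; lra. }
      destruct (Hloc h ltac:(lra)) as [_ H]. specialize (Hpos (s - h) ltac:(lra)). lra.
  - assert (Hsa : a < s).
    { destruct Has as [h|h]; [exact h|]. subst s. contradiction. }
    assert (Hc : continuity_pt f s) by (apply (continuity_pt_of_is_derive f s (df s)), Hd; lra).
    destruct (Rlt_le_dec 0 (f s)) as [Hp|Hn].
    + destruct Hsb as [Hsb|Hsb]; [|subst; exact Hp].
      destruct (continuity_pt_pos_local f s Hc Hp) as (eta & He & Hloc).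
      exfalso. apply (Hext eta He); auto.
      intros h Hh. apply Hloc. replace (s + h - s) with h by ring. rewrite Rabs_pos_eq; lra.
    + destruct (continuity_pt_pos_local (fun x => - f x) s) as (eta & He & Hloc).
      { apply continuity_pt_opp. exact Hc. } { lra. }
      set (h := Rmin eta (s - a) / 2).
      assert (Hm : 0 < h /\ h < eta /\ h < s - a).
      { unfold h, Rmin. destruct Rle_dec; lra. }
      specialize (Hpos (s - h) ltac:(lra)).
      specialize (Hloc (s - h)). replace (s - h - s) with (- h) in Hloc by ring.
      rewrite Rabs_Ropp, Rabs_pos_eq in Hloc by lra. specialize (Hloc ltac:(lra)). lra.
Qed.

Lemma Derive_eta (f : R -> R) (x l : R) : is_derive f x l -> Derive (fun t : R => f t) x = l.
Proof. apply is_derive_unique. Qed.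

Lemma bounded_sequence_converges (B : R) (u : nat -> R) : (forall k, Rabs (u k) <= B) ->
  exists (phi : nat -> nat) (l : R),
    filterlim phi eventually eventually /\ is_lim_seq (fun k => u (phi k)) l.
Proof.
  intros HB.
  destruct (Bolzano_Weierstrass u (fun c => - B <= c <= B)) as (l & Hl).
  { apply compact_P3. }
  { intros k. apply Rabs_le_between, HB. }
  assert (H : forall k : nat, exists j : nat, (k <= j)%nat /\ Rabs (u j - l) < / (INR k + 1)).
  { intros k.
    assert (Hk : 0 < / (INR k + 1)) by (apply Rinv_0_lt_compat; assert (Q := pos_INR k); lra).
    destruct (Hl (disc l (mkposreal _ Hk)) k) as (j & Hj & Hd).
    - exists (mkposreal _ Hk). intros z Hz. exact Hz.
    - exists j. split; [exact Hj|exact Hd]. }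
  apply functional_choice in H. destruct H as (phi & Hphi).
  exists phi, l. split.
  - intros P (N & HN). exists N. intros k Hk. apply HN. destruct (Hphi k). lia.
  - apply is_lim_seq_spec. intros eps.
    destruct (archimed_cor1 eps (cond_pos eps)) as (N & HN & HN0).
    exists N. intros k Hk. destruct (Hphi k) as [_ Hd].
    assert (HNk := le_INR _ _ Hk). assert (HN1 := lt_0_INR _ HN0).
    apply Rlt_trans with (1 := Hd). apply Rlt_trans with (2 := HN).
    apply Rinv_lt_contravar; nra.
Qed.

Lemma bounded_sequences_converge (B : R) (n : nat) (U : nat -> nat -> R) :
  (forall k i, (i <= n)%nat -> Rabs (U k i) <= B) ->
  exists (phi : nat -> nat) (l : nat -> R), filterlim phi eventually eventually /\
    forall i, (i <= n)%nat -> is_lim_seq (fun k => U (phi k) i) (Finite (l i)).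
Proof.
  revert U. induction n as [|n IH]; intros U HU.
  - destruct (bounded_sequence_converges B (fun k => U k O)) as (phi & l & H1 & H2).
    { intros k. apply HU. lia. }
    exists phi, (fun _ => l). split; [exact H1|]. intros i Hi. now replace i with O by lia.
  - destruct (IH U) as (phi & l & H1 & H2).
    { intros k i Hi. apply HU. lia. }
    destruct (bounded_sequence_converges B (fun k => U (phi k) (S n))) as (psi & c & H3 & H4).
    { intros k. apply HU. lia. }
    exists (fun k => phi (psi k)), (fun i => if Nat.eqb i (S n) then c else l i).
    split; [eapply filterlim_comp; eauto|].
    intros i Hi. destruct (Nat.eqb_spec i (S n)) as [->|E]; [exact H4|].
    apply (is_lim_seq_subseq (fun k => U (phi k) i) (l i) psi H3). apply H2. lia.
Qed.

(** * Convex curves parametrized by the tangent angle *)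

(** [m t] is the curvature radius at the point with tangent direction [(cos t, sin t)]. *)
Definition closed_convex (m X Y : R -> R) : Prop :=
  (forall t, 0 < m t) /\
  (forall t, is_derive X t (m t * cos t)) /\ (forall t, is_derive Y t (m t * sin t)) /\
  (forall t, X (t + 2 * PI) = X t) /\ (forall t, Y (t + 2 * PI) = Y t).

(** Here [g] is a right inverse obtained by choice, so its monotonicity and continuity are first
    deduced from the strict growth of [f]. *)
Lemma is_derive_inverse (f g df : R -> R) : (forall t, is_derive f t (df t)) -> (forall t, 0 < df t) ->
  (forall s, f (g s) = s) -> forall s, is_derive g s (/ df (g s)).
Proof.
  intros Hf Hpos Hg s.
  assert (Hinc : forall a b, a < b -> f a < f b).
  { intros a b Hab. apply (is_derive_pos_increasing f df); auto.
    intros x _. eapply continuity_pt_of_is_derive. apply Hf. }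
  assert (Hlt : forall a b, f a < f b -> a < b).
  { intros a b H. destruct (Rtotal_order a b) as [h|[->|h]]; [exact h|lra|].
    apply Hinc in h. lra. }
  assert (Hmono : forall a b, a <= b -> g a <= g b).
  { intros a b Hab. apply Rnot_lt_le. intros h. apply Hinc in h. rewrite !Hg in h. lra. }
  assert (Hc : continuity_pt g s).
  { intros eps He.
    assert (A1 := Hinc (g s - eps) (g s) ltac:(lra)). assert (A2 := Hinc (g s) (g s + eps) ltac:(lra)).
    rewrite Hg in A1, A2.
    exists (Rmin (s - f (g s - eps)) (f (g s + eps) - s)). split.
    - apply Rmin_pos; lra.
    - intros z (_ & Hz). simpl in *. unfold R_dist in *.
      assert (M1 := Rmin_l (s - f (g s - eps)) (f (g s + eps) - s)).
      assert (M2 := Rmin_r (s - f (g s - eps)) (f (g s + eps) - s)).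
      apply Rabs_def2 in Hz.
      apply Rabs_def1.
      + assert (g z < g s + eps) by (apply Hlt; rewrite Hg; lra). lra.
      + assert (g s - eps < g z) by (apply Hlt; rewrite Hg; lra). lra. }
  assert (Prf : forall a, g (s - 1) <= a <= g (s + 1) -> derivable_pt f a).
  { intros a _. exists (df a). apply is_derive_Reals, Hf. }
  assert (Hin : g (s - 1) <= g s <= g (s + 1)) by (split; apply Hmono; lra).
  assert (E : derive_pt f (g s) (Prf (g s) Hin) = df (g s)).
  { apply derive_pt_eq_0, is_derive_Reals, Hf. }
  apply is_derive_Reals.
  replace (/ df (g s)) with (1 / derive_pt f (g s) (Prf (g s) Hin)) by (rewrite E; unfold Rdiv; ring).
  apply (Ranalysis5.derivable_pt_lim_recip_interv f g (s - 1) (s + 1) s Prf Hc); try lra.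
  - intros z _. apply Hg.
  - rewrite E. specialize (Hpos (g s)). lra.
Qed.

Lemma is_derive_0_const (f : R -> R) : (forall t, is_derive f t 0) -> forall t, f t = f 0.
Proof.
  intros Hf t.
  destruct (MVT_gen f 0 t (fun _ => 0)) as (z & _ & E).
  - intros x _. apply Hf.
  - intros x _. eapply continuity_pt_of_is_derive. apply Hf.
  - lra.
Qed.

Lemma Derive_periodic (f : R -> R) (T : R) : (forall t, f (t + T) = f t) ->
  forall t, Derive f (t + T) = Derive f t.
Proof.
  intros Hf t. unfold Derive. f_equal. apply Lim_ext. intros h.
  replace (t + T + h) with (t + h + T) by ring. now rewrite !Hf.
Qed.

(** [f] gains the same positive amount over every period, hence passes every bound in both
    directions. This gives the tangent angle all real values. *)
Lemma unbounded_of_periodic_derivative (f df : R -> R) (T : R) : 0 < T ->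
  (forall t, is_derive f t (df t)) -> (forall t, 0 < df t) -> (forall t, df (t + T) = df t) ->
  forall s, exists t, f t = s.
Proof.
  intros HT Hf Hpos Hper s.
  assert (Hcont : forall t, continuity_pt f t).
  { intros t. eapply continuity_pt_of_is_derive. apply Hf. }
  set (C := f T - f 0).
  assert (HC : 0 < C).
  { unfold C. assert (f 0 < f T); [|lra]. apply (is_derive_pos_increasing f df); auto. }
  assert (Hstep : forall t, f (t + T) = f t + C).
  { intros t. enough (E : f (t + T) - f t = f (0 + T) - f 0).
    { rewrite Rplus_0_l in E. unfold C. lra. }
    apply (is_derive_0_const (fun t => f (t + T) - f t)). intros x.
    evar_last.
    - apply @is_derive_minus; [|apply Hf].
      apply (is_derive_comp f (fun x => x + T)); [apply Hf|].
      auto_derive; [trivial|reflexivity].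
    - rewrite Hper. unfold minus, plus, opp, scal; simpl; unfold mult; simpl. ring. }
  assert (Hn : forall (n : nat) t, f (t + INR n * T) = f t + INR n * C).
  { induction n as [|n IH]; intros t; [simpl; rewrite !Rmult_0_l, !Rplus_0_r; reflexivity|].
    rewrite S_INR. replace (t + (INR n + 1) * T) with (t + INR n * T + T) by ring.
    rewrite Hstep, IH. ring. }
  destruct (INR_archimed C (Rabs (s - f 0)) HC) as (n & Hbig).
  assert (Hup := Hn n 0). assert (Hlow := Hn n (- (INR n * T))).
  rewrite Rplus_0_l in Hup. replace (- (INR n * T) + INR n * T) with 0 in Hlow by ring.
  assert (Hs := Rabs_le_between (s - f 0) (Rabs (s - f 0))).
  destruct (proj1 Hs (Rle_refl _)) as (S1 & S2).
  destruct (IVT_gen f (- (INR n * T)) (INR n * T) s) as (t & _ & E).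
  - exact Hcont.
  - rewrite Rmin_left, Rmax_right by lra. lra.
  - now exists t.
Qed.

(** A direction [(cos tau, sin tau)] that turns at the rate of the velocity stays parallel to it:
    the components of the unit velocity along and across it are constant. *)
Lemma tangent_angle (vx vy dvx dvy : R -> R) :
  (forall t, is_derive vx t (dvx t)) -> (forall t, is_derive vy t (dvy t)) ->
  (forall t, 0 < vx t ^ 2 + vy t ^ 2) ->
  (forall t, continuous (fun t => (vx t * dvy t - vy t * dvx t) / (vx t ^ 2 + vy t ^ 2)) t) ->
  exists tau : R -> R,
    (forall t, is_derive tau t ((vx t * dvy t - vy t * dvx t) / (vx t ^ 2 + vy t ^ 2))) /\
    (forall t, vx t = sqrt (vx t ^ 2 + vy t ^ 2) * cos (tau t)) /\
    (forall t, vy t = sqrt (vx t ^ 2 + vy t ^ 2) * sin (tau t)).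
Proof.
  intros Hx Hy Hpos Hc.
  set (phi := fun t => (vx t * dvy t - vy t * dvx t) / (vx t ^ 2 + vy t ^ 2)) in *.
  (* Starting [tau] at the angle of the initial velocity gives [A 0 = 1] and [B 0 = 0]. *)
  destruct (polar_coordinates 0 (vx 0) (vy 0)) as (L & t0 & HL & _ & E1 & E2).
  set (tau := fun t => t0 + RInt phi 0 t).
  assert (Htau : forall t, is_derive tau t (phi t)).
  { intros t. unfold tau. evar_last.
    - apply @is_derive_plus; [apply is_derive_const|].
      apply (is_derive_RInt phi _ 0); [|apply Hc].
      apply filter_forall. intros z. apply (RInt_correct (V := R_CompleteNormedModule) phi), (ex_RInt_continuous (V := R_CompleteNormedModule)).
      intros y _. apply Hc.
    - unfold plus, zero; simpl. ring. }
  assert (Hq := sin2_cos2_pow t0).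
  assert (Htau0 : tau 0 = t0).
  { unfold tau. rewrite RInt_point. unfold zero; simpl. ring. }
  assert (HL2 : vx 0 ^ 2 + vy 0 ^ 2 = L ^ 2).
  { rewrite E1, E2. transitivity (L ^ 2 * (sin t0 ^ 2 + cos t0 ^ 2)); [ring|rewrite Hq; ring]. }
  assert (HLpos : 0 < L).
  { specialize (Hpos 0). rewrite HL2 in Hpos. destruct HL as [h|h]; [exact h|]. subst L. lra. }
  assert (HLs : sqrt (vx 0 ^ 2 + vy 0 ^ 2) = L) by (rewrite HL2; apply sqrt_pow2; lra).
  set (A := fun t => (vx t * cos (tau t) + vy t * sin (tau t)) / sqrt (vx t ^ 2 + vy t ^ 2)).
  set (B := fun t => (vy t * cos (tau t) - vx t * sin (tau t)) / sqrt (vx t ^ 2 + vy t ^ 2)).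
  assert (Hsq : forall t, 0 < sqrt (vx t ^ 2 + vy t ^ 2)) by (intros; apply sqrt_lt_R0, Hpos).
  assert (HA : forall t, is_derive A t 0).
  { intros t. unfold A. assert (P := Hpos t). assert (Q := Hsq t).
    assert (SS : sqrt (vx t ^ 2 + vy t ^ 2) * sqrt (vx t ^ 2 + vy t ^ 2) = vx t ^ 2 + vy t ^ 2)
      by (apply sqrt_sqrt; lra).
    auto_derive.
    - assert (ex_derive vx t) by (eexists; apply Hx). assert (ex_derive vy t) by (eexists; apply Hy).
      assert (ex_derive tau t) by (eexists; apply Htau). simpl in *. repeat split; auto. lra.
    - rewrite (Derive_eta vx _ _ (Hx t)), (Derive_eta vy _ _ (Hy t)), (Derive_eta tau _ _ (Htau t)).
      unfold phi.
      replace (vx t * (vx t * 1) + vy t * (vy t * 1)) with (vx t ^ 2 + vy t ^ 2) by ring.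
      set (z := sqrt (vx t ^ 2 + vy t ^ 2)) in *.
      rewrite <- SS. field_simplify_eq; [|lra].
      replace (z ^ 2) with (vx t ^ 2 + vy t ^ 2) by (rewrite <- SS; ring). ring. }
  assert (HB : forall t, is_derive B t 0).
  { intros t. unfold B. assert (P := Hpos t). assert (Q := Hsq t).
    assert (SS : sqrt (vx t ^ 2 + vy t ^ 2) * sqrt (vx t ^ 2 + vy t ^ 2) = vx t ^ 2 + vy t ^ 2)
      by (apply sqrt_sqrt; lra).
    auto_derive.
    - assert (ex_derive vx t) by (eexists; apply Hx). assert (ex_derive vy t) by (eexists; apply Hy).
      assert (ex_derive tau t) by (eexists; apply Htau). simpl in *. repeat split; auto. lra.
    - rewrite (Derive_eta vx _ _ (Hx t)), (Derive_eta vy _ _ (Hy t)), (Derive_eta tau _ _ (Htau t)).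
      unfold phi.
      replace (vx t * (vx t * 1) + vy t * (vy t * 1)) with (vx t ^ 2 + vy t ^ 2) by ring.
      set (z := sqrt (vx t ^ 2 + vy t ^ 2)) in *.
      rewrite <- SS. field_simplify_eq; [|lra].
      replace (z ^ 2) with (vx t ^ 2 + vy t ^ 2) by (rewrite <- SS; ring). ring. }
  assert (HA1 : forall t, A t = 1).
  { intros t. rewrite (is_derive_0_const A HA). unfold A. rewrite Htau0, HLs, E1, E2.
    apply Rmult_eq_reg_r with L; [|lra]. field_simplify; [|lra].
    transitivity (L * (sin t0 ^ 2 + cos t0 ^ 2)); [ring|rewrite Hq; ring]. }
  assert (HB0 : forall t, B t = 0).
  { intros t. rewrite (is_derive_0_const B HB). unfold B. rewrite Htau0, HLs, E1, E2. field. lra. }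
  exists tau. split; [exact Htau|].
  assert (G : forall t, vx t * cos (tau t) + vy t * sin (tau t) = sqrt (vx t ^ 2 + vy t ^ 2) /\
    vy t * cos (tau t) - vx t * sin (tau t) = 0).
  { intros t. assert (Q := Hsq t). assert (EA := HA1 t). assert (EB := HB0 t). unfold A, B in *.
    split.
    - apply Rmult_eq_reg_r with (/ sqrt (vx t ^ 2 + vy t ^ 2)); [|apply Rinv_neq_0_compat; lra].
      unfold Rdiv in EA. rewrite EA. field. lra.
    - apply Rmult_eq_reg_r with (/ sqrt (vx t ^ 2 + vy t ^ 2)); [|apply Rinv_neq_0_compat; lra].
      unfold Rdiv in EB. rewrite EB. ring. }
  split; intros t; destruct (G t) as (G1 & G2); rewrite <- G1; assert (Q := sin2_cos2_pow (tau t)).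
  - transitivity (vx t * (sin (tau t) ^ 2 + cos (tau t) ^ 2)
      + sin (tau t) * (vy t * cos (tau t) - vx t * sin (tau t))); [rewrite Q, G2; ring|ring].
  - transitivity (vy t * (sin (tau t) ^ 2 + cos (tau t) ^ 2)
      - cos (tau t) * (vy t * cos (tau t) - vx t * sin (tau t))); [rewrite Q, G2; ring|ring].
Qed.

(** Two such points would have parallel tangent lines of the same orientation, and each point would
    lie strictly to the left of the tangent at the other. *)
Lemma has_tangent_direction_unique (c : R -> plane) (theta : R) (P Q : plane) :
  regular c -> strictly_convex_ccw c ->
  has_tangent_direction c theta P -> has_tangent_direction c theta Q -> P = Q.
Proof.
  intros Hreg Hconv (s & -> & Hs1 & Hs2) (t & -> & Ht1 & Ht2).
  apply NNPP. intros Hne.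
  assert (A := Hconv s t Hne). assert (B := Hconv t s (not_eq_sym Hne)).
  rewrite Ht1, Ht2 in A. rewrite Hs1, Hs2 in B.
  assert (Ps := Hreg s). assert (Pt := Hreg t).
  set (z := cos theta * (ycoord c s - ycoord c t) - sin theta * (xcoord c s - xcoord c t)).
  assert (A' : 0 < speed c t * z) by (unfold z; lra).
  assert (B' : 0 < speed c s * (- z)) by (unfold z; lra).
  assert (0 < z) by nra. nra.
Qed.

(** The tangent angle grows at the rate curvature times speed, so its inverse [g] reparametrizes the
    curve with velocity [(cos s, sin s)] divided by the curvature. The period [2 PI] follows from
    the uniqueness of the point with a given direction; the total turning of the curve is never
    computed. *)
Lemma tangent_angle_parametrization (c : R -> plane) (T r : R) :
  convex_curve c T -> (forall t, curvature_radius c t < r) ->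
  exists rho : R -> R, (forall t, rho t < r) /\
    closed_convex rho (fun t => fst (gamma c t)) (fun t => snd (gamma c t)).
Proof.
  intros (Hsm & Hreg & (HT & Hper & _) & Hconv & Hcurv) Hrad.
  set (x := xcoord c). set (y := ycoord c).
  assert (Dx : forall t, is_derive x t (Derive x t)) by (intros t; apply Derive_correct, (Hsm 1%nat t)).
  assert (Dy : forall t, is_derive y t (Derive y t)) by (intros t; apply Derive_correct, (Hsm 1%nat t)).
  assert (DDx : forall t, is_derive (Derive x) t (Derive_n x 2 t)).
  { intros t. apply Derive_correct, (Hsm 2%nat t). }
  assert (DDy : forall t, is_derive (Derive y) t (Derive_n y 2 t)).
  { intros t. apply Derive_correct, (Hsm 2%nat t). }
  assert (Hsp : forall t, 0 < Derive x t ^ 2 + Derive y t ^ 2).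
  { intros t. apply Rnot_le_lt. intros h. assert (H := Hreg t). unfold speed in H.
    fold x y in H. rewrite sqrt_neg_0 in H by exact h. lra. }
  assert (Hphi : forall t, (Derive x t * Derive_n y 2 t - Derive y t * Derive_n x 2 t)
     / (Derive x t ^ 2 + Derive y t ^ 2) = curvature c t * speed c t).
  { intros t. unfold curvature. fold x y. assert (H := Hreg t).
    assert (E : speed c t ^ 2 = Derive x t ^ 2 + Derive y t ^ 2).
    { unfold speed. fold x y. apply pow2_sqrt. specialize (Hsp t). lra. }
    rewrite <- E. field. lra. }
  destruct (tangent_angle (Derive x) (Derive y) (Derive_n x 2) (Derive_n y 2)) as (tau & T1 & T2 & T3); auto.
  { intros t. apply (ex_derive_continuous (V := R_NormedModule)).
    assert (Derive x t ^ 2 + Derive y t ^ 2 <> 0) by (specialize (Hsp t); lra).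
    assert (A1 : ex_derive (Derive x) t) by (eexists; apply DDx).
    assert (A2 : ex_derive (Derive y) t) by (eexists; apply DDy).
    assert (A3 : ex_derive (Derive_n x 2) t) by (apply (Hsm 3%nat t)).
    assert (A4 : ex_derive (Derive_n y 2) t) by (apply (Hsm 3%nat t)).
    apply (ex_derive_div (fun t => Derive x t * Derive_n y 2 t - Derive y t * Derive_n x 2 t)
      (fun t => Derive x t ^ 2 + Derive y t ^ 2)); [| |assumption].
    - apply (ex_derive_minus (V := R_NormedModule)); apply ex_derive_mult; assumption.
    - apply (ex_derive_plus (V := R_NormedModule)); apply ex_derive_pow; assumption. }
  assert (Hpos : forall t, 0 < curvature c t * speed c t).
  { intros t. apply Rmult_lt_0_compat; [apply Hcurv|apply Hreg]. }
  assert (T1' : forall t, is_derive tau t (curvature c t * speed c t)).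
  { intros t. rewrite <- Hphi. apply T1. }
  assert (Px : forall t, x (t + T) = x t) by (intros t; unfold x, xcoord; now rewrite Hper).
  assert (Py : forall t, y (t + T) = y t) by (intros t; unfold y, ycoord; now rewrite Hper).
  assert (Pphi : forall t, curvature c (t + T) * speed c (t + T) = curvature c t * speed c t).
  { intros t. rewrite <- !Hphi.
    change (Derive_n x 2) with (Derive (Derive x)). change (Derive_n y 2) with (Derive (Derive y)).
    now rewrite !(Derive_periodic (Derive x) T), !(Derive_periodic (Derive y) T),
      !(Derive_periodic x T), !(Derive_periodic y T) by (repeat (apply Derive_periodic || assumption)). }
  assert (Hsurj := unbounded_of_periodic_derivative tau _ T HT T1' Hpos Pphi).
  apply functional_choice in Hsurj. destruct Hsurj as (g & Hg).
  assert (Dg := is_derive_inverse tau g _ T1' Hpos Hg).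
  assert (Hdir : forall s, has_tangent_direction c s (c (g s))).
  { intros s. exists (g s). split; [reflexivity|]. fold x y. unfold speed. fold x y.
    split; [rewrite T2 at 1|rewrite T3 at 1]; now rewrite Hg. }
  assert (Hspec : forall s, has_tangent_direction c s (gamma c s)).
  { intros s. apply (epsilon_spec (inhabits (0, 0)) (has_tangent_direction c s)).
    exists (c (g s)). apply Hdir. }
  assert (Hgam : forall s, gamma c s = c (g s)).
  { intros s. apply (has_tangent_direction_unique c s); auto. }
  assert (Hgper : forall s, gamma c (s + 2 * PI) = gamma c s).
  { intros s. apply (has_tangent_direction_unique c s); auto.
    destruct (Hspec (s + 2 * PI)) as (t & A & B & C).
    exists t. split; [exact A|]. rewrite B, C.
    replace (s + 2 * PI) with (s + 2 * PI * IZR 1) by ring.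
    now rewrite cos_translate, sin_translate. }
  exists (fun s => curvature_radius c (g s)). split; [intros; apply Hrad|].
  assert (Hdx : forall s, Derive x (g s) = speed c (g s) * cos s).
  { intros s. rewrite T2. unfold speed. fold x y. now rewrite Hg. }
  assert (Hdy : forall s, Derive y (g s) = speed c (g s) * sin s).
  { intros s. rewrite T3. unfold speed. fold x y. now rewrite Hg. }
  split; [|split; [|split; [|split]]].
  - intros s. apply Rinv_0_lt_compat, Hcurv.
  - intros s. apply (is_derive_ext (fun s => x (g s))); [intros; now rewrite Hgam|].
    evar_last; [apply (is_derive_comp x g); [apply Dx|apply Dg]|].
    rewrite Hdx. unfold scal; simpl; unfold mult; simpl. unfold curvature_radius.
    specialize (Hreg (g s)). specialize (Hcurv (g s)). field. lra.
  - intros s. apply (is_derive_ext (fun s => y (g s))); [intros; now rewrite Hgam|].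
    evar_last; [apply (is_derive_comp y g); [apply Dy|apply Dg]|].
    rewrite Hdy. unfold scal; simpl; unfold mult; simpl. unfold curvature_radius.
    specialize (Hreg (g s)). specialize (Hcurv (g s)). field. lra.
  - intros s. now rewrite Hgper.
  - intros s. now rewrite Hgper.
Qed.

(** * Support functions of a convex curve *)

(** The projection of the curve on its outward normal [(sin phi, - cos phi)] has derivative
    [m t * sin (phi - t)]: it increases up to [phi] and decreases afterwards. *)
Lemma support_lt_PI (m X Y : R -> R) (s phi : R) :
  closed_convex m X Y -> s <> phi -> phi - PI <= s <= phi + PI ->
  (X s - X phi) * sin phi - (Y s - Y phi) * cos phi < 0.
Proof.
  intros (Hm & HX & HY & _ & _) Hne Hs.
  set (F := fun t => sin phi * X t - cos phi * Y t).
  assert (HF : forall t, is_derive F t (m t * sin (phi - t))).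
  { intros t. unfold F.
    evar_last.
    - apply @is_derive_minus; apply is_derive_scal; [apply HX|apply HY].
    - unfold minus, plus, opp; simpl. rewrite sin_minus. ring. }
  assert (Hc : forall t, continuity_pt F t).
  { intros t. eapply continuity_pt_of_is_derive. apply HF. }
  enough (F s < F phi) by (unfold F in *; lra).
  destruct (Rtotal_order s phi) as [h|[h|h]]; [|contradiction|].
  - apply (is_derive_pos_increasing F (fun t => m t * sin (phi - t))); auto.
    intros t Ht. apply Rmult_lt_0_compat; [apply Hm|apply sin_gt_0; lra].
  - apply Ropp_lt_cancel.
    apply (is_derive_pos_increasing (fun t => - F t) (fun t => - (m t * sin (phi - t)))); auto.
    + intros t _. apply continuity_pt_opp, Hc.
    + intros t _. apply @is_derive_opp. apply HF.
    + intros t Ht. assert (H : sin (phi - t) < 0) by (apply sin_lt_0_var; lra).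
      specialize (Hm t). nra.
Qed.

Lemma support_lt (m X Y : R -> R) (s phi : R) :
  closed_convex m X Y -> s <> phi -> phi - 2 * PI < s < phi + 2 * PI ->
  (X s - X phi) * sin phi - (Y s - Y phi) * cos phi < 0.
Proof.
  intros H Hne Hs. assert (HPI := PI_RGT_0).
  destruct (Rlt_dec s (phi - PI)) as [h|h]; [|destruct (Rlt_dec (phi + PI) s) as [h'|h']].
  - rewrite <- (proj1 (proj2 (proj2 (proj2 H))) s), <- (proj2 (proj2 (proj2 (proj2 H))) s).
    apply (support_lt_PI m); auto; lra.
  - replace s with (s - 2 * PI + 2 * PI) by ring.
    rewrite (proj1 (proj2 (proj2 (proj2 H)))), (proj2 (proj2 (proj2 (proj2 H)))).
    apply (support_lt_PI m); auto; lra.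
  - apply (support_lt_PI m); auto; lra.
Qed.

Lemma support_le (m X Y : R -> R) (s phi : R) :
  closed_convex m X Y -> (X s - X phi) * sin phi - (Y s - Y phi) * cos phi <= 0.
Proof.
  intros H. destruct (two_PI_translate (phi - PI) s) as (k & Hk).
  rewrite <- (periodic_Z X (proj1 (proj2 (proj2 (proj2 H)))) k s).
  rewrite <- (periodic_Z Y (proj2 (proj2 (proj2 (proj2 H)))) k s).
  destruct (Req_dec (s + 2 * PI * IZR k) phi) as [->|Hn].
  - lra.
  - apply Rlt_le, (support_lt_PI m); auto; lra.
Qed.

Lemma sin_gt_bounds (d a : R) :
  0 < d < PI / 2 -> 0 < a < PI -> sin d < sin a -> d < a < PI - d.
Proof.
  intros Hd Ha H. split; apply Rnot_le_lt; intros Hc.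
  - apply (Rlt_not_le (sin a) (sin d)); [exact H|]. apply sin_incr_1; lra.
  - apply (Rlt_not_le (sin a) (sin d)); [exact H|]. rewrite <- (sin_PI_x a).
    apply sin_incr_1; lra.
Qed.

(** * The circles and their centers *)

Section Centers.

Context (r : R) (rho X Y : R -> R).
Context (gamma_convex : closed_convex rho X Y).
Context (rho_lt : forall t, rho t < r).

Definition Ox (t : R) : R := X t - r * sin t.
Definition Oy (t : R) : R := Y t + r * cos t.
Definition w (t : R) : R := r - rho t.

Lemma r_pos : 0 < r.
Proof. destruct gamma_convex as (H & _). specialize (H 0). specialize (rho_lt 0). lra. Qed.

Lemma w_pos t : 0 < w t.
Proof. unfold w. specialize (rho_lt t). lra. Qed.

Lemma is_derive_Ox t : is_derive Ox t (- w t * cos t).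
Proof.
  destruct gamma_convex as (_ & HX & _). unfold Ox.
  evar_last.
  - apply @is_derive_minus; [apply HX|]. apply is_derive_scal, is_derive_sin.
  - unfold minus, plus, opp, w; simpl. ring.
Qed.

Lemma is_derive_Oy t : is_derive Oy t (- w t * sin t).
Proof.
  destruct gamma_convex as (_ & _ & HY & _). unfold Oy.
  evar_last.
  - apply @is_derive_plus; [apply HY|]. apply is_derive_scal, is_derive_cos.
  - unfold plus, w; simpl. ring.
Qed.

Lemma Ox_periodic t : Ox (t + 2 * PI) = Ox t.
Proof.
  destruct gamma_convex as (_ & _ & _ & H & _). unfold Ox. rewrite H.
  rewrite sin_plus, cos_2PI, sin_2PI. ring.
Qed.

Lemma Oy_periodic t : Oy (t + 2 * PI) = Oy t.
Proof.
  destruct gamma_convex as (_ & _ & _ & _ & H). unfold Oy. rewrite H.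
  rewrite cos_plus, cos_2PI, sin_2PI. ring.
Qed.

(** The centers move against the tangent direction, so it is the reflected curve [- O] that has
    tangent angle [t] and curvature radius [w t]. The support inequalities thus apply to the centers
    too. *)
Lemma centers_convex : closed_convex w (fun t => - Ox t) (fun t => - Oy t).
Proof.
  split; [exact w_pos|]. split; [|split; [|split]].
  - intros t. evar_last; [apply @is_derive_opp, is_derive_Ox|]. unfold opp; simpl; ring.
  - intros t. evar_last; [apply @is_derive_opp, is_derive_Oy|]. unfold opp; simpl; ring.
  - intros t. now rewrite Ox_periodic.
  - intros t. now rewrite Oy_periodic.
Qed.

(** The farthest point of the curve from a center lies in the normal direction
    at that point, where the support functions of the curve and of the disc compare. *)
Lemma curve_inside_disc (s x : R) :
  s <> x -> x - 2 * PI < s < x + 2 * PI ->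
  (X s - Ox x) ^ 2 + (Y s - Oy x) ^ 2 < r ^ 2.
Proof.
  intros Hne Hs. assert (HPI := PI_RGT_0). assert (Hr := r_pos).
  (* [phi] is chosen so that its outward normal points from the center at [x] to [gamma(s)]; the
     branch keeps [phi] within [PI] of [s], as [support_lt_PI] requires. *)
  destruct (polar_coordinates (s - PI) (- (Y s - Oy x)) (X s - Ox x)) as (L & phi & HL & Hphi & Hu & Hv).
  assert (H1 := sin2_cos2_pow phi).
  assert (E : (X s - Ox x) ^ 2 + (Y s - Oy x) ^ 2 = L ^ 2).
  { replace ((Y s - Oy x) ^ 2) with ((- (Y s - Oy x)) ^ 2) by ring. rewrite Hu, Hv.
    transitivity (L ^ 2 * (sin phi ^ 2 + cos phi ^ 2)); [ring|rewrite H1; ring]. }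
  rewrite E. enough (L < r) by nra.
  (* The distance is [r] plus two support differences, one of the curve and one of the reflected
     centers. Both are nonpositive; the first is strictly negative unless [phi = s], and then the
     second is. *)
  assert (EL : L = ((X s - X phi) * sin phi - (Y s - Y phi) * cos phi)
                  + (r + ((- Ox x - - Ox phi) * sin phi - (- Oy x - - Oy phi) * cos phi))).
  { transitivity (L * (sin phi ^ 2 + cos phi ^ 2)); [rewrite H1; ring|].
    transitivity ((X s - Ox x) * sin phi + (- (Y s - Oy x)) * cos phi).
    - rewrite Hu, Hv. ring.
    - transitivity ((X s - Ox x) * sin phi + (- (Y s - Oy x)) * cos phi
        + r * (1 - (sin phi ^ 2 + cos phi ^ 2))); [rewrite H1; ring|]. unfold Ox, Oy. ring. }
  destruct (Req_dec phi s) as [h|h].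
  - subst phi.
    assert (A := support_lt _ _ _ x s centers_convex (not_eq_sym Hne) ltac:(lra)).
    cbv beta in A. lra.
  - assert (A := support_lt_PI _ _ _ s phi gamma_convex (not_eq_sym h) ltac:(lra)).
    assert (B := support_le _ _ _ x phi centers_convex). cbv beta in B. lra.
Qed.

(** For [x < y < x + 2 PI] the circles at [x] and [y] meet at the point reached
    from the first tangency point by turning through [a] and from the second by
    turning through [- b]; the centers are at distance [2 r sin d]. *)
Definition chord (x y a b d : R) : Prop :=
  0 < a /\ 0 < b /\ 0 < d /\ a + 2 * d < PI /\ b + 2 * d < PI /\ y = x + a + b + 2 * d /\
  Ox x - Ox y = 2 * r * sin d * cos (x + a + d) /\
  Oy x - Oy y = 2 * r * sin d * sin (x + a + d).

(** [L] and [psi] are length and direction of [O(x) - O(y)]. That [gamma(x)] is inside the circle at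
    [y] reads [L < 2 r sin (psi - x)], and that [gamma(y)] is inside the circle at [x] reads
    [L < 2 r sin (y - psi)]. With [L = 2 r sin d] both angles lie strictly between [d] and [PI - d],
    so [a = psi - x - d] and [b = y - psi - d] are positive. *)
Lemma chord_exists (x y : R) : x < y < x + 2 * PI -> exists a b d, chord x y a b d.
Proof.
  intros Hxy. assert (HPI := PI_RGT_0). assert (Hr := r_pos).
  destruct (polar_coordinates (x - PI) (Ox x - Ox y) (Oy x - Oy y)) as (L & psi & HL & Hpsi & Hu & Hv).
  assert (H1 := sin2_cos2_pow psi).
  assert (C1 : L * (L - 2 * r * sin (psi - x)) < 0).
  { assert (H := curve_inside_disc x y ltac:(lra) ltac:(lra)).
    replace (X x - Ox y) with ((Ox x - Ox y) + r * sin x) in H by (unfold Ox; ring).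
    replace (Y x - Oy y) with ((Oy x - Oy y) - r * cos x) in H by (unfold Oy; ring).
    rewrite Hu, Hv in H. rewrite sin_minus.
    assert (H2 := sin2_cos2_pow x).
    assert (E : (L * cos psi + r * sin x) ^ 2 + (L * sin psi - r * cos x) ^ 2 =
      L ^ 2 * (sin psi ^ 2 + cos psi ^ 2) + r ^ 2 * (sin x ^ 2 + cos x ^ 2)
      - 2 * r * L * (sin psi * cos x - cos psi * sin x)) by ring.
    rewrite E, H1, H2 in H. lra. }
  assert (C2 : L * (L - 2 * r * sin (y - psi)) < 0).
  { assert (H := curve_inside_disc y x ltac:(lra) ltac:(lra)).
    replace (X y - Ox x) with (- (Ox x - Ox y) + r * sin y) in H by (unfold Ox; ring).
    replace (Y y - Oy x) with (- (Oy x - Oy y) - r * cos y) in H by (unfold Oy; ring).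
    rewrite Hu, Hv in H. rewrite sin_minus.
    assert (H2 := sin2_cos2_pow y).
    assert (E : (- (L * cos psi) + r * sin y) ^ 2 + (- (L * sin psi) - r * cos y) ^ 2 =
      L ^ 2 * (sin psi ^ 2 + cos psi ^ 2) + r ^ 2 * (sin y ^ 2 + cos y ^ 2)
      - 2 * r * L * (sin y * cos psi - cos y * sin psi)) by ring.
    rewrite E, H1, H2 in H. lra. }
  assert (HL0 : 0 < L) by (destruct HL as [h|h]; [exact h|subst L; lra]).
  assert (S1 : L / (2 * r) < sin (psi - x)).
  { apply Rmult_lt_reg_r with (2 * r); [lra|]. unfold Rdiv. rewrite Rmult_assoc, Rinv_l by lra. nra. }
  assert (S2 : L / (2 * r) < sin (y - psi)).
  { apply Rmult_lt_reg_r with (2 * r); [lra|]. unfold Rdiv. rewrite Rmult_assoc, Rinv_l by lra. nra. }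
  assert (HLr : 0 < L / (2 * r)) by (apply Rdiv_lt_0_compat; lra).
  assert (HLr1 : L / (2 * r) < 1) by (destruct (SIN_bound (psi - x)); lra).
  set (d := asin (L / (2 * r))).
  assert (Hsd : sin d = L / (2 * r)) by (apply sin_asin; lra).
  assert (Hd : 0 < d < PI / 2).
  { split; [|apply asin_bound_lt; lra]. apply Rnot_le_lt. intros Hc.
    assert (B := asin_bound (L / (2 * r))). fold d in B.
    assert (sin d <= 0) by (rewrite <- sin_0; apply sin_incr_1; lra). lra. }
  rewrite <- Hsd in S1, S2.
  assert (Hsd0 : 0 < sin d) by lra.
  assert (A1 : 0 < psi - x < PI).
  { split; [|lra]. apply Rnot_le_lt. intros Hc.
    assert (0 <= sin (- (psi - x))) by (apply sin_ge_0; lra). rewrite sin_neg in H. lra. }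
  assert (A2 : 0 < y - psi < PI).
  { split; apply Rnot_le_lt; intros Hc.
    - assert (0 <= sin (- (y - psi))) by (apply sin_ge_0; lra). rewrite sin_neg in H. lra.
    - assert (sin (y - psi) <= 0) by (apply sin_le_0; lra). lra. }
  apply sin_gt_bounds in S1; auto. apply sin_gt_bounds in S2; auto.
  exists (psi - x - d), (y - psi - d), d.
  unfold chord. rewrite Hu, Hv, Hsd.
  replace (x + (psi - x - d) + d) with psi by ring.
  replace (2 * r * (L / (2 * r))) with L by (field; lra).
  repeat split; lra.
Qed.


Lemma chord_vertex (x y a b d : R) : chord x y a b d ->
  Ox x + r * sin (x + a) = Ox y + r * sin (y - b) /\
  Oy x - r * cos (x + a) = Oy y - r * cos (y - b).
Proof.
  intros (_ & _ & _ & _ & _ & Hy & Hu & Hv).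
  replace (x + a) with ((x + a + d) - d) by ring.
  replace (y - b) with ((x + a + d) + d) by lra.
  set (psi := x + a + d) in *.
  rewrite (sin_minus psi), (cos_minus psi), (sin_plus psi), (cos_plus psi). split; nra.
Qed.

(** The points of the circle at [y] that lie before the vertex, seen from the
    tangency point, are those inside the circle at [x]. *)
Lemma power_on_circle (x y a b d s : R) : chord x y a b d ->
  (Ox y + r * sin (y - s) - Ox x) ^ 2 + (Oy y - r * cos (y - s) - Oy x) ^ 2 - r ^ 2
  = 4 * r ^ 2 * sin d * (sin d - sin (b + d - s)).
Proof.
  intros (_ & _ & _ & _ & _ & Hy & Hu & Hv).
  replace (b + d - s) with ((y - s) - (x + a + d)) by lra.
  set (psi := x + a + d) in *. set (c := y - s).
  replace (Ox y + r * sin c - Ox x) with (r * sin c - (Ox x - Ox y)) by ring.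
  replace (Oy y - r * cos c - Oy x) with (- r * cos c - (Oy x - Oy y)) by ring.
  rewrite Hu, Hv, (sin_minus c psi).
  assert (H1 := sin2_cos2_pow psi). assert (H2 := sin2_cos2_pow c).
  transitivity (r ^ 2 * (sin c ^ 2 + cos c ^ 2) + 4 * r ^ 2 * sin d ^ 2 * (sin psi ^ 2 + cos psi ^ 2)
    - 4 * r ^ 2 * sin d * (sin c * cos psi - cos c * sin psi) - r ^ 2); [ring|].
  rewrite H1, H2. ring.
Qed.

Lemma chord_sin_pos (x y a b d : R) : chord x y a b d -> 0 < sin d /\ d < PI / 2.
Proof.
  intros (Ha & Hb & Hd & Had & Hbd & _). split; [apply sin_gt_0; lra|lra].
Qed.

Lemma sin_lt_sin (d t : R) : 0 < d < PI / 2 -> d < t < PI - d -> sin d < sin t.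
Proof.
  intros Hd Ht. destruct (Rle_dec t (PI / 2)).
  - apply sin_increasing_1; lra.
  - rewrite <- (sin_PI_x t). apply sin_increasing_1; lra.
Qed.

Lemma sin_lt_sin_below (d t : R) : 0 < d < PI / 2 -> d - PI < t < d -> sin t < sin d.
Proof.
  intros Hd Ht. destruct (Rle_dec t 0).
  - assert (0 <= sin (- t)) by (apply sin_ge_0; lra). rewrite sin_neg in H.
    assert (0 < sin d) by (apply sin_gt_0; lra). lra.
  - apply sin_increasing_1; lra.
Qed.

(** The other intersection of the circles is at [s = b + 2 d - PI] modulo [2 PI], which misses the
    interval from 0 to [PI]. *)
Lemma power_zero (x y a b d s : R) : chord x y a b d -> 0 < s < PI ->
  (Ox y + r * sin (y - s) - Ox x) ^ 2 + (Oy y - r * cos (y - s) - Oy x) ^ 2 - r ^ 2 = 0 ->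
  s = b.
Proof.
  intros H Hs. rewrite (power_on_circle x y a b d s H).
  destruct (chord_sin_pos _ _ _ _ _ H) as (H1 & H2).
  destruct H as (Ha & Hb & Hd & Had & Hbd & _).
  assert (Hr := r_pos). intros E.
  assert (E2 : sin d = sin (b + d - s)).
  { apply Rmult_eq_reg_l with (4 * r ^ 2 * sin d); [lra|].
    apply Rgt_not_eq, Rmult_lt_0_compat; [|exact H1]. assert (0 < r ^ 2) by (apply pow_lt; lra). lra. }
  destruct (Rtotal_order s b) as [h|[h|h]]; [exfalso|exact h|exfalso].
  - assert (sin d < sin (b + d - s)) by (apply sin_lt_sin; lra). lra.
  - assert (sin (b + d - s) < sin d) by (apply sin_lt_sin_below; lra). lra.
Qed.

Lemma power_pos (x y a b d s : R) : chord x y a b d -> 0 < s < PI ->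
  0 < (Ox y + r * sin (y - s) - Ox x) ^ 2 + (Oy y - r * cos (y - s) - Oy x) ^ 2 - r ^ 2 ->
  b < s.
Proof.
  intros H Hs. rewrite (power_on_circle x y a b d s H).
  destruct (chord_sin_pos _ _ _ _ _ H) as (H1 & H2).
  destruct H as (Ha & Hb & Hd & Had & Hbd & _).
  assert (Hr := r_pos). intros E. apply Rnot_le_lt. intros h.
  assert (E2 : sin d <= sin (b + d - s)).
  { destruct h as [h|h]; [apply Rlt_le, sin_lt_sin; lra|].
    subst s. replace (b + d - b) with d by ring. lra. }
  assert (0 < 4 * r ^ 2 * sin d).
  { apply Rmult_lt_0_compat; [|exact H1]. assert (0 < r ^ 2) by (apply pow_lt; lra). lra. }
  nra.
Qed.

(** As [z] increases, the circle at [z] moves across a fixed point of the circle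
    at [y] only outwards, because the crossing point is the vertex. *)
Lemma chord_angle_decreasing (x x' y a b d a' b' d' : R) :
  chord x y a b d -> chord x' y a' b' d' -> x < x' -> b' < b.
Proof.
  intros H H' Hx. assert (HPI := PI_RGT_0). assert (Hr := r_pos).
  assert (Hb : 0 < b < PI) by (destruct H as (? & ? & ? & ? & ? & _); lra).
  assert (Hxy : y < x + 2 * PI) by (destruct H as (? & ? & ? & ? & ? & ? & _); lra).
  assert (Hx'y : x' < y) by (destruct H' as (? & ? & ? & ? & ? & ? & _); lra).
  set (u := Ox y + r * sin (y - b)). set (v := Oy y - r * cos (y - b)).
  set (h := fun z => (u - Ox z) ^ 2 + (v - Oy z) ^ 2 - r ^ 2).
  set (dh := fun z => 2 * w z * ((u - Ox z) * cos z + (v - Oy z) * sin z)).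
  apply (power_pos x' y a' b' d'); auto. fold u v.
  apply (pos_after_zero h dh x x'); auto.
  - intros z _. unfold h, dh.
    assert (A := is_derive_Ox z). assert (B := is_derive_Oy z).
    auto_derive.
    + split; [exists (- w z * cos z); exact A|]. split; [exists (- w z * sin z); exact B|trivial].
    + rewrite (Derive_eta Ox _ _ A), (Derive_eta Oy _ _ B). ring.
  - unfold h, u, v. destruct (chord_vertex _ _ _ _ _ H) as (E1 & E2).
    rewrite <- E1, <- E2. assert (Q := sin2_cos2_pow (x + a)).
    transitivity (r ^ 2 * (sin (x + a) ^ 2 + cos (x + a) ^ 2 - 1)); [ring|rewrite Q; ring].
  - intros z Hz Ez.
    destruct (chord_exists z y) as (az & bz & dz & Hc); [lra|].
    (* At a zero [z] the fixed point lies on both circles at an angle between 0 and [PI], so it is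
       the vertex for [z] and [y]. The derivative there is [2 w(z) r sin az], which is positive. *)
    assert (Eb := power_zero _ _ _ _ _ b Hc Hb Ez).
    destruct (chord_vertex _ _ _ _ _ Hc) as (E1 & E2). subst bz.
    unfold dh, u, v. rewrite <- E1, <- E2.
    assert (Ha : 0 < sin az).
    { destruct Hc as (? & ? & ? & ? & ? & _). apply sin_gt_0; lra. }
    replace ((Ox z + r * sin (z + az) - Ox z) * cos z + (Oy z - r * cos (z + az) - Oy z) * sin z)
      with (r * (sin (z + az) * cos z - cos (z + az) * sin z)) by ring.
    rewrite <- sin_minus. replace (z + az - z) with az by ring.
    assert (Hw := w_pos z). apply Rmult_lt_0_compat; [lra|nra].
Qed.

(** * The generating function and its partial derivatives *)

(** Half the area of the part of a disc of radius [r] outside an equal disc whose center is [2 r u]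
    away. As a function of the distance, rather than of the angle [d], it makes [K] defined for all
    pairs and periodic in each variable. *)
Definition cap (u : R) : R := r ^ 2 * (asin u + u * sqrt (1 - u ^ 2)).

Definition dist_centers (x y : R) : R := sqrt ((Ox x - Ox y) ^ 2 + (Oy x - Oy y) ^ 2).

(** [r ^ 2 / 2 * (y - x) + K x y] is the contribution of the vertex between the sides
    at [x] and [y] to the area (see [arc_area_turning]); [cap (sin d)] is [r ^ 2 * (d + sin d * cos d)]. *)
Definition K (x y : R) : R :=
  (Ox x * Oy y - Oy x * Ox y) / 2 - cap (dist_centers x y / (2 * r)).

Lemma is_derive_cap (u : R) : -1 < u < 1 -> is_derive cap u (2 * r ^ 2 * sqrt (1 - u ^ 2)).
Proof.
  intros Hu.
  assert (Hs : 0 < 1 - u ^ 2) by nra.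
  assert (Hs2 : 0 < sqrt (1 - u ^ 2)) by (apply sqrt_lt_R0; exact Hs).
  assert (A : is_derive asin u (/ sqrt (1 - u ^ 2))).
  { apply is_derive_Reals. replace (/ sqrt (1 - u ^ 2)) with (derive_pt asin u (derivable_pt_asin u Hu)).
    - apply (proj1 (derive_pt_eq _ _ _ _) eq_refl).
    - rewrite derive_pt_asin. unfold Rsqr, Rdiv. rewrite Rmult_1_l. do 3 f_equal. ring. }
  unfold cap. auto_derive.
  - split; [exists (/ sqrt (1 - u ^ 2)); exact A|]. split; [|trivial].
    replace (1 + - (u * (u * 1))) with (1 - u ^ 2) by ring. exact Hs.
  - rewrite (Derive_eta asin _ _ A).
    replace (1 + - (u * (u * 1))) with (1 - u ^ 2) by ring.
    replace (1 - u * (u * 1)) with (1 - u ^ 2) by ring.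
    assert (Q : sqrt (1 - u ^ 2) * sqrt (1 - u ^ 2) = 1 - u ^ 2) by (apply sqrt_sqrt; lra).
    set (z := sqrt (1 - u ^ 2)) in *.
    field_simplify; [|lra..].
    replace (u ^ 2) with (1 - z * z) by lra. field. lra.
Qed.

(** Common to both partial derivatives of [K]: [(p, q)] is the fixed center and [(f, g)] the moving
    one. The condition [0 < d] keeps the square root away from 0. *)
Lemma is_derive_cap_dist (f g : R -> R) (f' g' p q t d psi : R) :
  is_derive f t f' -> is_derive g t g' -> 0 < d < PI / 2 ->
  p - f t = 2 * r * sin d * cos psi -> q - g t = 2 * r * sin d * sin psi ->
  is_derive (fun s => cap (sqrt ((p - f s) ^ 2 + (q - g s) ^ 2) / (2 * r))) t
    (- (r * cos d) * (f' * cos psi + g' * sin psi)).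
Proof.
  intros Hf Hg Hd Hp Hq. assert (Hr := r_pos). assert (HPI := PI_RGT_0).
  assert (Hsd : 0 < sin d) by (apply sin_gt_0; lra).
  assert (Hcd : 0 < cos d) by (apply cos_gt_0; lra).
  assert (Hsc := sin2_cos2_pow d).
  assert (H1 := sin2_cos2_pow psi).
  assert (E : (p - f t) ^ 2 + (q - g t) ^ 2 = (2 * r * sin d) ^ 2).
  { rewrite Hp, Hq.
    transitivity ((2 * r * sin d) ^ 2 * (sin psi ^ 2 + cos psi ^ 2)); [ring|rewrite H1; ring]. }
  assert (Es : sqrt ((p - f t) ^ 2 + (q - g t) ^ 2) = 2 * r * sin d).
  { rewrite E. apply sqrt_pow2. nra. }
  assert (Hpos : 0 < (2 * r * sin d) ^ 2) by (apply pow_lt; nra).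
  set (D := fun s => sqrt ((p - f s) ^ 2 + (q - g s) ^ 2) / (2 * r)).
  assert (HD : is_derive D t (- (f' * cos psi + g' * sin psi) / (2 * r))).
  { unfold D. auto_derive.
    - split; [exists f'; exact Hf|]. split; [exists g'; exact Hg|]. split; [|trivial].
      replace ((p + - f t) * ((p + - f t) * 1) + (q + - g t) * ((q + - g t) * 1))
        with ((p - f t) ^ 2 + (q - g t) ^ 2) by ring. rewrite E. exact Hpos.
    - rewrite (Derive_eta f _ _ Hf), (Derive_eta g _ _ Hg).
      replace ((p + - f t) * ((p + - f t) * 1) + (q + - g t) * ((q + - g t) * 1))
        with ((p - f t) ^ 2 + (q - g t) ^ 2) by ring.
      rewrite Es.
      replace (p + - f t) with (2 * r * sin d * cos psi) by lra.
      replace (q + - g t) with (2 * r * sin d * sin psi) by lra.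
      replace (p - f t) with (2 * r * sin d * cos psi) by lra.
      replace (q - g t) with (2 * r * sin d * sin psi) by lra.
      field. lra. }
  assert (ED : D t = sin d) by (unfold D; rewrite Es; field; lra).
  evar_last.
  - apply (is_derive_comp cap D t); [|exact HD].
    apply is_derive_cap. rewrite ED.
    split; [lra|]. assert (sin d < 1) by nra. assumption.
  - rewrite ED. unfold scal; simpl; unfold mult; simpl.
    replace (sqrt (1 - _)) with (cos d).
    + field. lra.
    + symmetry. replace (1 - sin d * (sin d * 1)) with (cos d ^ 2) by (simpl in *; lra).
      apply sqrt_pow2. lra.
Qed.

(** This is [det(O(t), O'(t)) / 2], the rate at which the center sweeps area about the origin. It
    enters the two partial derivatives of [K] with opposite signs and so cancels in [K a m + K m b]
    as a function of [m]. *)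
Definition drift (t : R) : R := w t * (Oy t * cos t - Ox t * sin t) / 2.

Lemma is_derive_K_r (x y a b d : R) : chord x y a b d ->
  is_derive (K x) y (drift y - w y * r * cos b).
Proof.
  intros H. destruct (chord_sin_pos _ _ _ _ _ H) as (H1 & H2).
  assert (Hd : 0 < d < PI / 2) by (destruct H as (? & ? & ? & _); lra).
  destruct H as (_ & _ & _ & _ & _ & Hy & Hu & Hv).
  assert (A := is_derive_cap_dist Ox Oy _ _ (Ox x) (Oy x) y d (x + a + d)
     (is_derive_Ox y) (is_derive_Oy y) Hd Hu Hv).
  unfold K, dist_centers.
  evar_last.
  - apply @is_derive_minus; [|exact A].
    apply (is_derive_ext (fun y => / 2 * (Ox x * Oy y - Oy x * Ox y))).
    { intros t. simpl. field. }
    apply is_derive_scal. apply @is_derive_minus; apply is_derive_scal;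
      [apply is_derive_Oy|apply is_derive_Ox].
  - unfold minus, plus, opp; simpl. unfold drift.
    replace b with ((y - (x + a + d)) - d) by lra.
    replace (Ox x) with (Ox y + 2 * r * sin d * cos (x + a + d)) by lra.
    replace (Oy x) with (Oy y + 2 * r * sin d * sin (x + a + d)) by lra.
    set (psi := x + a + d) in *.
    rewrite (cos_minus (y - psi) d), (sin_minus y psi), (cos_minus y psi). field.
Qed.

Lemma is_derive_K_l (x y a b d : R) : chord x y a b d ->
  is_derive (fun x => K x y) x (- drift x + w x * r * cos a).
Proof.
  intros H. destruct (chord_sin_pos _ _ _ _ _ H) as (H1 & H2).
  assert (Hd : 0 < d < PI / 2) by (destruct H as (? & ? & ? & _); lra).
  destruct H as (_ & _ & _ & _ & _ & Hy & Hu & Hv).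
  (* Now the center at [x] moves and the one at [y] is fixed, which reverses the direction between
     them. *)
  assert (A := is_derive_cap_dist Ox Oy _ _ (Ox y) (Oy y) x d (x + a + d + PI)
     (is_derive_Ox x) (is_derive_Oy x) Hd).
  rewrite neg_cos, neg_sin in A. specialize (A ltac:(lra) ltac:(lra)).
  apply (is_derive_ext (fun x => / 2 * (Oy y * Ox x - Ox y * Oy x)
     - cap (sqrt ((Ox y - Ox x) ^ 2 + (Oy y - Oy x) ^ 2) / (2 * r)))).
  { intros t. unfold K, dist_centers.
    replace ((Ox y - Ox t) ^ 2 + (Oy y - Oy t) ^ 2) with ((Ox t - Ox y) ^ 2 + (Oy t - Oy y) ^ 2) by ring.
    simpl. field. }
  evar_last.
  - apply @is_derive_minus; [|exact A].
    apply is_derive_scal. apply @is_derive_minus; apply is_derive_scal;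
      [apply is_derive_Ox|apply is_derive_Oy].
  - unfold minus, plus, opp; simpl. unfold drift.
    replace (Ox y) with (Ox x - 2 * r * sin d * cos (x + a + d)) by lra.
    replace (Oy y) with (Oy x - 2 * r * sin d * sin (x + a + d)) by lra.
    set (psi := x + a + d) in *.
    replace a with ((psi - x) - d) by (unfold psi; ring).
    rewrite (cos_minus (psi - x) d), (sin_minus psi x), (cos_minus psi x). field.
Qed.

Lemma K_periodic_r (x y : R) : K x (y + 2 * PI) = K x y.
Proof. unfold K, dist_centers. now rewrite Ox_periodic, Oy_periodic. Qed.

Lemma K_periodic_l (x y : R) : K (x + 2 * PI) y = K x y.
Proof. unfold K, dist_centers. now rewrite Ox_periodic, Oy_periodic. Qed.

Lemma K_diag (x : R) : K x x = 0.
Proof.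
  unfold K, dist_centers, cap.
  replace ((Ox x - Ox x) ^ 2 + (Oy x - Oy x) ^ 2) with 0 by ring.
  rewrite sqrt_0. unfold Rdiv. rewrite Rmult_0_l, asin_0. ring.
Qed.

Definition strip (x y : R) : Prop := x <= y <= x + 2 * PI.

Lemma K_chord (x y a b d : R) : chord x y a b d ->
  K x y = (Ox x * Oy y - Oy x * Ox y) / 2 - r ^ 2 * (d + sin d * cos d) /\
  dist_centers x y / (2 * r) = sin d.
Proof.
  intros H. destruct (chord_sin_pos _ _ _ _ _ H) as (H1 & H2).
  assert (Hd : 0 < d) by (destruct H as (? & ? & ? & _); lra).
  assert (Hr := r_pos). assert (HPI := PI_RGT_0).
  destruct H as (_ & _ & _ & _ & _ & Hy & Hu & Hv).
  assert (E : dist_centers x y / (2 * r) = sin d).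
  { unfold dist_centers. rewrite Hu, Hv. set (psi := x + a + d).
    replace (_ + _) with ((2 * r * sin d) ^ 2 * (sin psi ^ 2 + cos psi ^ 2)) by ring.
    rewrite sin2_cos2_pow, Rmult_1_r, sqrt_pow2 by nra. field. lra. }
  split; [|exact E]. unfold K. rewrite E. unfold cap. rewrite asin_sin by lra.
  do 3 f_equal. f_equal.
  assert (Hsc := sin2_cos2_pow d).
  replace (1 - sin d ^ 2) with (cos d ^ 2) by lra. apply sqrt_pow2.
  apply Rlt_le, cos_gt_0; lra.
Qed.

(** Keeps the argument of [cap] where [cap] is differentiable, also on the boundary of the strip,
    where the centers coincide. *)
Lemma dist_centers_lt (x y : R) : strip x y -> 0 <= dist_centers x y / (2 * r) < 1.
Proof.
  intros Hs. assert (Hr := r_pos).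
  split.
  { apply Rmult_le_pos; [apply sqrt_pos|]. apply Rlt_le, Rinv_0_lt_compat. lra. }
  assert (E0 : Ox x = Ox y -> Oy x = Oy y -> dist_centers x y / (2 * r) < 1).
  { intros E1 E2. unfold dist_centers. rewrite E1, E2.
    replace ((Ox y - Ox y) ^ 2 + (Oy y - Oy y) ^ 2) with 0 by ring.
    rewrite sqrt_0. unfold Rdiv. rewrite Rmult_0_l. lra. }
  destruct (Req_dec x y) as [->|Hn]; [auto|].
  destruct (Req_dec y (x + 2 * PI)) as [->|Hn'].
  { apply E0; [now rewrite Ox_periodic|now rewrite Oy_periodic]. }
  unfold strip in Hs.
  destruct (chord_exists x y) as (a & b & d & H); [lra|].
  rewrite (proj2 (K_chord _ _ _ _ _ H)).
  assert (Hsc := sin2_cos2_pow d).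
  destruct (chord_sin_pos _ _ _ _ _ H) as (H1 & H2).
  assert (0 < cos d).
  { apply cos_gt_0; [|lra]. destruct H as (? & ? & ? & _). lra. }
  nra.
Qed.

(** The general filter serves both continuity in one variable and limits along sequences of
    polygons. *)
Lemma filterlim_K {T : Type} (F : (T -> Prop) -> Prop) {FF : Filter F} (f g : T -> R) (x y : R) :
  strip x y -> filterlim f F (locally x) -> filterlim g F (locally y) ->
  filterlim (fun t => K (f t) (g t)) F (locally (K x y)).
Proof.
  intros Hs Hf Hg.
  assert (C : forall h : R -> R, (forall t, ex_derive h t) -> forall (k : T -> R) z,
    filterlim k F (locally z) -> filterlim (fun t => h (k t)) F (locally (h z))).
  { intros h Hh k z Hk. eapply filterlim_comp; [exact Hk|]. apply (ex_derive_continuous h). apply Hh. }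
  assert (HOx := C Ox (fun t => ex_intro _ _ (is_derive_Ox t))).
  assert (HOy := C Oy (fun t => ex_intro _ _ (is_derive_Oy t))).
  assert (P : forall (k1 k2 : T -> R) z1 z2, filterlim k1 F (locally z1) -> filterlim k2 F (locally z2) ->
    filterlim (fun t => k1 t + k2 t) F (locally (z1 + z2))).
  { intros. eapply (filterlim_comp_2 (G := locally z1) (H := locally z2)); eauto.
    apply (filterlim_plus (V := R_NormedModule)). }
  assert (M : forall (k1 k2 : T -> R) z1 z2, filterlim k1 F (locally z1) -> filterlim k2 F (locally z2) ->
    filterlim (fun t => k1 t * k2 t) F (locally (z1 * z2))).
  { intros. eapply (filterlim_comp_2 (G := locally z1) (H := locally z2)); eauto.
    apply (filterlim_mult (K := R_AbsRing)). }
  assert (N : forall (k : T -> R) z, filterlim k F (locally z) ->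
    filterlim (fun t => - k t) F (locally (- z))).
  { intros. eapply filterlim_comp; [eassumption|]. apply (filterlim_opp (V := R_NormedModule)). }
  assert (B : forall c : R, filterlim (fun _ : T => c) F (locally c)) by (intros; apply filterlim_const).
  unfold K, Rminus, Rdiv. apply P; [apply M; [apply P|apply B]|apply N].
  - apply M; auto.
  - apply N, M; auto.
  - apply (filterlim_comp _ _ _ (fun t => dist_centers (f t) (g t) * / (2 * r)) cap F
      (locally (dist_centers x y * / (2 * r)))).
    + apply M; [|apply B]. unfold dist_centers.
      apply (filterlim_comp _ _ _ (fun t => (Ox (f t) - Ox (g t)) ^ 2 + (Oy (f t) - Oy (g t)) ^ 2) sqrt F
        (locally ((Ox x - Ox y) ^ 2 + (Oy x - Oy y) ^ 2))); [|apply continuous_sqrt].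
      simpl. apply P; (apply M; [|apply M; [|apply B]]); apply P; auto.
    + apply (ex_derive_continuous cap).
      assert (Q := dist_centers_lt x y Hs). unfold Rdiv in Q.
      eexists. apply is_derive_cap. lra.
Qed.

Lemma continuity_pt_K_r (x y : R) : strip x y -> continuity_pt (K x) y.
Proof.
  intros Hs. apply continuity_pt_filterlim.
  apply (filterlim_K (locally y) (fun _ => x) (fun t => t) x y Hs).
  - apply filterlim_const.
  - apply filterlim_id.
Qed.

(** * The Monge and twist inequalities *)

(** In [K x s - K x' s] the drift cancels and the derivative is [w s * r * (cos b' - cos b)],
    positive since [b' < b]. The derivative is used on the open interval only, so [x' = y] and
    [y' = x + 2 PI] are allowed. *)
Lemma K_Monge (x x' y y' : R) :
  x < x' -> x' <= y -> y < y' -> y' <= x + 2 * PI ->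
  K x y + K x' y' < K x y' + K x' y.
Proof.
  intros H1 H2 H3 H4.
  set (phi := fun s => K x s - K x' s).
  enough (phi y < phi y') by (unfold phi in *; lra).
  apply (is_derive_pos_increasing phi (fun s => Derive (K x) s - Derive (K x') s)); auto.
  - intros s Hs. apply continuity_pt_minus; apply continuity_pt_K_r; unfold strip; lra.
  - intros s Hs.
    destruct (chord_exists x s) as (a & b & d & H); [lra|].
    destruct (chord_exists x' s) as (a' & b' & d' & H'); [lra|].
    apply @is_derive_minus; apply Derive_correct.
    + eexists. apply (is_derive_K_r _ _ _ _ _ H).
    + eexists. apply (is_derive_K_r _ _ _ _ _ H').
  - intros s Hs.
    destruct (chord_exists x s) as (a & b & d & H); [lra|].
    destruct (chord_exists x' s) as (a' & b' & d' & H'); [lra|].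
    rewrite (is_derive_unique (K x) _ _ (is_derive_K_r _ _ _ _ _ H)).
    rewrite (is_derive_unique (K x') _ _ (is_derive_K_r _ _ _ _ _ H')).
    assert (Hb := chord_angle_decreasing _ _ _ _ _ _ _ _ _ H H' H1).
    destruct H as (? & ? & ? & ? & ? & _). destruct H' as (? & ? & ? & ? & ? & _).
    assert (cos b < cos b') by (apply cos_decreasing_1; lra).
    assert (Hw := w_pos s). assert (Hr := r_pos). assert (0 < w s * r) by nra. nra.
Qed.

(** The derivative of [K a m + K m b] in [m] is [w m * r * (cos alpha - cos beta)], where
    [alpha] depends on [m] and [b] only and [beta] increases strictly as [a] decreases. *)
Lemma K_twist (a a' m b : R) :
  a < a' -> a' < m -> m < b -> m < a + 2 * PI -> b < m + 2 * PI ->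
  (forall m1, m < m1 -> m1 < a' + 2 * PI -> m1 < b -> K a' m + K m b <= K a' m1 + K m1 b) ->
  exists m1, a < m1 < m /\ b < m1 + 2 * PI /\ K a m1 + K m1 b < K a m + K m b.
Proof.
  intros H1 H2 H3 H4 H5 Hmin.
  destruct (chord_exists a m) as (al & be & de & C); [lra|].
  destruct (chord_exists a' m) as (al' & be' & de' & C'); [lra|].
  destruct (chord_exists m b) as (al2 & be2 & de2 & C2); [lra|].
  assert (Hb := chord_angle_decreasing _ _ _ _ _ _ _ _ _ C C' H1).
  assert (D : is_derive (fun t => K a t + K t b) m (w m * r * (cos al2 - cos be))).
  { evar_last; [apply @is_derive_plus; [apply (is_derive_K_r _ _ _ _ _ C)|apply (is_derive_K_l _ _ _ _ _ C2)]|].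
    unfold plus; simpl; ring. }
  assert (D' : is_derive (fun t => - (K a' t + K t b)) m (- (w m * r * (cos al2 - cos be')))).
  { evar_last.
    - apply @is_derive_opp, @is_derive_plus;
        [apply (is_derive_K_r _ _ _ _ _ C')|apply (is_derive_K_l _ _ _ _ _ C2)].
    - unfold opp, plus; simpl; ring. }
  assert (Hw : 0 < w m * r) by (apply Rmult_lt_0_compat; [apply w_pos|apply r_pos]).
  assert (Hcos : cos be < cos be').
  { destruct C as (? & ? & ? & ? & ? & _). destruct C' as (? & ? & ? & ? & ? & _).
    apply cos_decreasing_1; lra. }
  (* Otherwise moving [m] slightly forward would lower [K a' m + K m b], against [Hmin]. *)
  assert (Hle : cos be' <= cos al2).
  { apply Rnot_lt_le. intros Hc.
    destruct (is_derive_pos_local _ _ _ D') as (eta & He & Hloc); [nra|].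
    set (h := Rmin eta (Rmin (b - m) (a' + 2 * PI - m)) / 2).
    assert (Hh : 0 < h /\ h < eta /\ h < b - m /\ h < a' + 2 * PI - m).
    { unfold h, Rmin. repeat destruct Rle_dec; lra. }
    destruct (Hloc h ltac:(lra)) as [Hl _].
    specialize (Hmin (m + h) ltac:(lra) ltac:(lra) ltac:(lra)). lra. }
  (* Now [cos be < cos al2], so with [a] in place of [a'] the sum increases at [m], and moving [m]
     backward lowers it. *)
  destruct (is_derive_pos_local _ _ _ D) as (eta & He & Hloc); [nra|].
  set (h := Rmin eta (Rmin (m - a) (m + 2 * PI - b)) / 2).
  assert (Hh : 0 < h /\ h < eta /\ h < m - a /\ h < m + 2 * PI - b).
  { unfold h, Rmin. repeat destruct Rle_dec; lra. }
  destruct (Hloc h ltac:(lra)) as [_ Hl].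
  exists (m - h). repeat split; lra.
Qed.

(** * Minimal sequences of tangent directions *)

Fixpoint cost (n : nat) (u : nat -> R) : R :=
  match n with O => 0 | S m => cost m u + K (u m) (u (S m)) end.

Definition path (n : nat) (u : nat -> R) : Prop := forall i, (i < n)%nat -> strip (u i) (u (S i)).

Definition closed_path (p n : nat) (u : nat -> R) : Prop :=
  path n u /\ u n = u O + 2 * PI * INR p.

Definition update (u : nat -> R) (j : nat) (m : R) (i : nat) : R := if Nat.eqb i j then m else u i.

Lemma update_eq (u : nat -> R) (j : nat) (m : R) : update u j m j = m.
Proof. unfold update. now rewrite Nat.eqb_refl. Qed.

Lemma update_neq (u : nat -> R) (i j : nat) (m : R) : i <> j -> update u j m i = u i.
Proof. intros H. unfold update. now rewrite (proj2 (Nat.eqb_neq i j) H). Qed.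

Lemma cost_ext (n : nat) (u v : nat -> R) :
  (forall i, (i <= n)%nat -> u i = v i) -> cost n u = cost n v.
Proof.
  induction n as [|n IH]; intros H; simpl; [reflexivity|].
  rewrite IH by (intros; apply H; lia). now rewrite !H by lia.
Qed.

Lemma path_ext (n : nat) (u v : nat -> R) :
  (forall i, (i <= n)%nat -> u i = v i) -> path n u -> path n v.
Proof. intros H Hu i Hi. rewrite <- !H by lia. now apply Hu. Qed.

Lemma cost_S_l (n : nat) (u : nat -> R) : cost (S n) u = K (u 0%nat) (u 1%nat) + cost n (fun i => u (S i)).
Proof. induction n as [|n IH]; [simpl; ring|]. change (cost (S n) u + K (u (S n)) (u (S (S n))) =
  K (u 0%nat) (u 1%nat) + (cost n (fun i => u (S i)) + K (u (S n)) (u (S (S n))))). rewrite IH. ring. Qed.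

Lemma cost_update (n i : nat) (u : nat -> R) (m : R) : (S i < n)%nat ->
  cost n (update u (S i) m) = cost n u + (K (u i) m + K m (u (S (S i))))
    - (K (u i) (u (S i)) + K (u (S i)) (u (S (S i)))).
Proof.
  induction n as [|n IH]; intros H; [lia|]. simpl.
  destruct (Nat.eq_dec (S i) n) as [E|E].
  - subst n. simpl. rewrite update_eq, !update_neq by lia.
    rewrite (cost_ext i (update u (S i) m) u) by (intros; apply update_neq; lia). ring.
  - rewrite IH by lia. rewrite !update_neq by lia. ring.
Qed.

Lemma path_update (n i : nat) (u : nat -> R) (m : R) : path n u ->
  strip (u i) m -> strip m (u (S (S i))) -> path n (update u (S i) m).
Proof.
  intros Hu H1 H2 k Hk. destruct (Nat.eq_dec k (S i)) as [->|E].
  - now rewrite update_eq, update_neq by lia.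
  - rewrite (update_neq u k) by lia. destruct (Nat.eq_dec k i) as [->|E2].
    + now rewrite update_eq.
    + rewrite update_neq by lia. now apply Hu.
Qed.

Lemma K_translate (k : Z) (x y : R) : K (x + 2 * PI * IZR k) (y + 2 * PI * IZR k) = K x y.
Proof.
  rewrite (periodic_Z (K (x + 2 * PI * IZR k)) (K_periodic_r _)).
  apply (periodic_Z (fun x => K x y)). intros z. apply K_periodic_l.
Qed.

Lemma cost_translate (n : nat) (k : Z) (u : nat -> R) :
  cost n (fun i => u i + 2 * PI * IZR k) = cost n u.
Proof. induction n as [|n IH]; simpl; [reflexivity|]. now rewrite IH, K_translate. Qed.

Lemma closed_path_translate (p n : nat) (k : Z) (u : nat -> R) :
  closed_path p n u -> closed_path p n (fun i => u i + 2 * PI * IZR k).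
Proof.
  intros [H1 H2]. split; [|rewrite H2; ring].
  intros i Hi. specialize (H1 i Hi). unfold strip in *. lra.
Qed.

Lemma circumscribed_closed_path (p q k : nat) (th : nat -> R) :
  circumscribed p q th -> closed_path p q (fun i => th (i + k)%nat).
Proof.
  intros [H1 H2]. split.
  - intros i _. specialize (H2 (i + k)%nat). unfold strip. simpl. lra.
  - rewrite <- H1. f_equal. lia.
Qed.

(** Each shift moves the first term to the end, where periodicity gives it the same value. A minimal
    polygon may therefore be started at any of its sides. *)
Lemma cost_shift (p q k : nat) (th : nat -> R) :
  circumscribed p q th -> cost q (fun i => th (i + k)%nat) = cost q th.
Proof.
  intros [H1 H2]. induction k as [|k IH].
  - apply cost_ext. intros i _. f_equal. lia.
  - rewrite <- IH.
    assert (E := cost_S_l q (fun i => th (i + k)%nat)). simpl in E.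
    rewrite (cost_ext q (fun i => th (i + S k)%nat) (fun i => th (S (i + k)))) by (intros; f_equal; lia).
    assert (E2 : K (th (q + k)%nat) (th (S (q + k))) = K (th k) (th (S k))).
    { replace (q + k)%nat with (k + q)%nat by lia. replace (S (k + q)) with (S k + q)%nat by lia.
      rewrite !H1, !INR_IZR_INZ. apply K_translate. }
    lra.
Qed.

(** Closed paths constrain finitely many indices, polygons all of them; this leads from the former
    to the latter. *)
Definition periodic_extension (p n : nat) (u : nat -> R) (i : nat) : R :=
  u (i mod n)%nat + 2 * PI * INR p * INR (i / n)%nat.

Lemma periodic_extension_eq (p n : nat) (u : nat -> R) (i : nat) :
  (0 < n)%nat -> closed_path p n u -> (i <= n)%nat -> periodic_extension p n u i = u i.
Proof.
  intros Hn [_ Hc] Hi. unfold periodic_extension.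
  destruct (Nat.eq_dec i n) as [->|E].
  - rewrite Nat.Div0.mod_same, Nat.div_same by lia. rewrite Hc. simpl. ring.
  - rewrite Nat.mod_small, Nat.div_small by lia. simpl. ring.
Qed.

Lemma periodic_extension_circumscribed (p n : nat) (u : nat -> R) :
  (0 < n)%nat -> closed_path p n u -> circumscribed p n (periodic_extension p n u).
Proof.
  intros Hn Hu. assert (Hper : forall i k, periodic_extension p n u (i + k * n) =
    periodic_extension p n u i + 2 * PI * INR p * INR k).
  { intros i k. unfold periodic_extension.
    rewrite Nat.Div0.mod_add, Nat.div_add, plus_INR by lia. ring. }
  split.
  - intros i. replace (i + n)%nat with (i + 1 * n)%nat by lia. rewrite Hper. simpl. ring.
  - intros i. assert (Hi := Nat.div_mod_eq i n).
    assert (Hlt := Nat.mod_upper_bound i n ltac:(lia)).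
    set (k := (i / n)%nat) in *. set (j := (i mod n)%nat) in *.
    replace (S i) with (S j + k * n)%nat by lia. replace i with (j + k * n)%nat by lia.
    rewrite !Hper, !periodic_extension_eq by (auto; lia).
    destruct Hu as [Hu _]. specialize (Hu j Hlt). unfold strip in Hu. lra.
Qed.

(** * Existence of minimal closed paths *)

Definition minimal (p n : nat) (u : nat -> R) : Prop :=
  closed_path p n u /\ forall v, closed_path p n v -> cost n u <= cost n v.

Lemma path_le (n i : nat) (u : nat -> R) : path n u -> (i <= n)%nat ->
  u O <= u i <= u O + 2 * PI * INR i.
Proof.
  intros Hu. induction i as [|i IH]; intros Hi; [simpl; lra|].
  specialize (IH ltac:(lia)). specialize (Hu i ltac:(lia)). unfold strip in Hu.
  rewrite S_INR. lra.
Qed.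

Lemma is_lim_seq_cost (n : nat) (U : nat -> nat -> R) (l : nat -> R) : path n l ->
  (forall i, (i <= n)%nat -> is_lim_seq (fun k => U k i) (l i)) ->
  is_lim_seq (fun k => cost n (U k)) (cost n l).
Proof.
  intros Hl HU. induction n as [|n IH]; simpl.
  - apply is_lim_seq_const.
  - apply is_lim_seq_plus'.
    + apply IH; [intros i Hi; apply Hl; lia|intros; apply HU; lia].
    + apply (filterlim_K eventually); [apply Hl; lia| |]; apply HU; lia.
Qed.

Lemma closed_path_limit (p n : nat) (U : nat -> nat -> R) (l : nat -> R) :
  (forall k, closed_path p n (U k)) ->
  (forall i, (i <= n)%nat -> is_lim_seq (fun k => U k i) (l i)) -> closed_path p n l.
Proof.
  intros HU Hl. split.
  - intros i Hi. assert (H1 := Hl i ltac:(lia)). assert (H2 := Hl (S i) ltac:(lia)). split.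
    + apply (is_lim_seq_le (fun k => U k i) (fun k => U k (S i)) (l i) (l (S i))); auto.
      intros k. apply (proj1 (HU k) i Hi).
    + apply (is_lim_seq_le (fun k => U k (S i)) (fun k => U k i + 2 * PI) (l (S i)) (l i + 2 * PI)); auto.
      * intros k. apply (proj1 (HU k) i Hi).
      * apply is_lim_seq_plus'; [exact H1|apply is_lim_seq_const].
  - assert (H1 := Hl n ltac:(lia)). assert (H2 := Hl O ltac:(lia)).
    assert (H3 : is_lim_seq (fun k => U k n) (l O + 2 * PI * INR p)).
    { apply (is_lim_seq_ext (fun k => U k O + 2 * PI * INR p)).
      - intros k. symmetry. apply (proj2 (HU k)).
      - apply is_lim_seq_plus'; [exact H2|apply is_lim_seq_const]. }
    assert (E := is_lim_seq_unique _ _ H1). rewrite (is_lim_seq_unique _ _ H3) in E.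
    now injection E.
Qed.

(** Compactness: after a translation by a multiple of [2 PI] the first entry lies between 0 and
    [2 PI], which bounds all others, and a minimizing sequence has a convergent subsequence. *)
Lemma minimal_exists (p n : nat) : (1 <= p)%nat -> (p <= n)%nat -> exists u, minimal p n u.
Proof.
  intros Hp Hn. assert (HPI := PI_RGT_0).
  (* The arctangent makes the set of values bounded with no prior lower bound on the cost; the sign
     turns the infimum into a supremum. *)
  set (E := fun z => exists u, closed_path p n u /\ z = - atan (cost n u)).
  destruct (completeness E) as (s & Hub & Hlub).
  { exists (PI / 2). intros z (u & _ & ->). destruct (atan_bound (cost n u)). lra. }
  (* Equally spaced directions; their step [2 PI p / n] is admissible because [p <= n]. *)
  { exists (- atan (cost n (fun i => 2 * PI * INR p * (INR i / INR n)))).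
    exists (fun i => 2 * PI * INR p * (INR i / INR n)). split; [|reflexivity].
    assert (Hn0 : 0 < INR n) by (apply lt_0_INR; lia).
    assert (Hp0 : INR p <= INR n) by (apply le_INR; lia).
    assert (Hp1 := pos_INR p).
    split.
    - intros i _. unfold strip. rewrite S_INR.
      replace ((INR i + 1) / INR n) with (INR i / INR n + / INR n) by (field; lra).
      assert (0 <= INR p * / INR n <= 1).
      { split; [apply Rmult_le_pos; [lra|apply Rlt_le, Rinv_0_lt_compat; lra]|].
        apply Rmult_le_reg_r with (INR n); [lra|]. rewrite Rmult_assoc, Rinv_l by lra. lra. }
      nra.
    - simpl. field. lra. }
  assert (Hk : forall k : nat, exists u, closed_path p n u /\ 0 <= u O <= 2 * PI /\
            atan (cost n u) < - s + / (INR k + 1)).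
  { intros k. apply NNPP. intros Hno.
    assert (Hk : 0 < / (INR k + 1)) by (apply Rinv_0_lt_compat; assert (Q := pos_INR k); lra).
    apply (Rlt_not_le s (s - / (INR k + 1))); [lra|]. apply Hlub.
    intros z (u & Hu & ->). apply Rnot_lt_le. intros Hlt. apply Hno.
    destruct (two_PI_translate 0 (u O)) as (j & Hj).
    exists (fun i => u i + 2 * PI * IZR j). split; [now apply closed_path_translate|].
    split; [lra|]. rewrite cost_translate. lra. }
  apply functional_choice in Hk. destruct Hk as (U & HU).
  destruct (bounded_sequences_converge (2 * PI + 2 * PI * INR n) n U) as (phi & l & Hphi & Hl).
  { intros k i Hi. destruct (HU k) as ([Hpath _] & H0 & _).
    assert (H1 := path_le n i (U k) Hpath Hi).
    assert (H2 := le_INR _ _ Hi). assert (H3 := pos_INR i). apply Rabs_le. nra. }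
  assert (Hcl : closed_path p n l).
  { apply (closed_path_limit p n (fun k => U (phi k))); auto. intros k. apply (HU (phi k)). }
  exists l. split; [exact Hcl|]. intros v Hv.
  assert (Hlim : is_lim_seq (fun k => atan (cost n (U (phi k)))) (atan (cost n l))).
  { apply is_lim_seq_continuous; [apply derivable_continuous_pt, derivable_pt_atan|].
    apply (is_lim_seq_cost n (fun k => U (phi k))); [apply Hcl|exact Hl]. }
  assert (Hle : atan (cost n l) <= - s + 0).
  { apply (is_lim_seq_le (fun k => atan (cost n (U (phi k))))
      (fun k => - s + / (INR (phi k) + 1)) (atan (cost n l)) (- s + 0)); auto.
    - intros k. apply Rlt_le, HU.
    - apply is_lim_seq_plus'; [apply is_lim_seq_const|].
      apply (is_lim_seq_subseq (fun k => / (INR k + 1)) 0 phi Hphi).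
      apply (is_lim_seq_ext (fun k => / INR (S k))).
      { intros k. now rewrite S_INR. }
      apply (is_lim_seq_incr_1 (fun k => / INR k)).
      apply (is_lim_seq_inv INR p_infty); [apply is_lim_seq_INR|discriminate]. }
  assert (Hs : - atan (cost n v) <= s) by (apply Hub; exists v; auto).
  apply Rnot_lt_le. intros Hc. apply atan_increasing in Hc. lra.
Qed.

(** * Exchanging steps of two sequences *)

Lemma K_full (x : R) : K x (x + 2 * PI) = 0.
Proof. now rewrite K_periodic_r, K_diag. Qed.

(** The Monge inequality with both middle arguments equal to [m], where [K m m = 0]. *)
Lemma K_insert (a m b : R) : a < m -> m < b -> b <= a + 2 * PI -> K a m + K m b < K a b.
Proof. intros H1 H2 H3. assert (H := K_Monge a m m b). rewrite K_diag in H. lra. Qed.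

(** Shortening a full step lowers the sum. This Monge inequality, with one term vanishing on a full
    step, stands in for the derivative that is missing there; [K_full_right] treats a full second
    step. *)
Lemma K_full_left (m m1 b : R) : m1 < m -> m <= b -> b < m1 + 2 * PI ->
  K (m - 2 * PI) m1 + K m1 b < K (m - 2 * PI) m + K m b.
Proof.
  intros H1 H2 H3. assert (H := K_Monge m1 m b (m1 + 2 * PI)).
  rewrite K_full, K_periodic_r in H. rewrite <- !(K_periodic_l (m - 2 * PI)).
  replace (m - 2 * PI + 2 * PI) with m by ring. rewrite K_diag. lra.
Qed.

Lemma K_full_right (a m m1 : R) : a <= m -> m < m1 -> m1 < a + 2 * PI ->
  K a m1 + K m1 (m + 2 * PI) < K a m + K m (m + 2 * PI).
Proof.
  intros H1 H2 H3. assert (H := K_Monge m1 (a + 2 * PI) (m + 2 * PI) (m1 + 2 * PI)).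
  rewrite !K_full, !K_periodic_l, !(K_periodic_r a) in H. rewrite K_full. lra.
Qed.

(** Extends [K_twist] to full steps: [b = m + 2 PI] contradicts the minimality assumed for [a'], and
    for [m = a + 2 PI] shortening the first step already gains. The midpoints are arbitrary interior
    choices. *)
Lemma K_twist_strip (a a' m b : R) : a < a' -> a' < m -> m < b -> strip a m -> strip m b ->
  (forall m1, strip a' m1 -> strip m1 b -> K a' m + K m b <= K a' m1 + K m1 b) ->
  exists m1, strip a m1 /\ strip m1 b /\ K a m1 + K m1 b < K a m + K m b.
Proof.
  intros H1 H2 H3 S1 S2 Hmin. unfold strip in *. assert (HPI := PI_RGT_0).
  destruct (Req_dec b (m + 2 * PI)) as [->|Hb].
  { exfalso. assert (H := K_full_right a' m ((m + (a' + 2 * PI)) / 2)).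
    specialize (Hmin ((m + (a' + 2 * PI)) / 2) ltac:(lra) ltac:(lra)).
    specialize (H ltac:(lra) ltac:(lra) ltac:(lra)). lra. }
  destruct (Req_dec m (a + 2 * PI)) as [E|Ha].
  - replace a with (m - 2 * PI) in * by lra.
    exists (((b - 2 * PI) + m) / 2). repeat split; try lra.
    apply K_full_left; lra.
  - destruct (K_twist a a' m b) as (m1 & M1 & M2 & M3); try lra.
    + intros m1 M1 M2 M3. apply Hmin; lra.
    + exists m1. repeat split; lra.
Qed.

Lemma strip_min_max (a a2 b b2 : R) : strip a a2 -> strip b b2 ->
  strip (Rmin a b) (Rmin a2 b2) /\ strip (Rmax a b) (Rmax a2 b2).
Proof. unfold strip, Rmin, Rmax. intros. repeat destruct Rle_dec; lra. Qed.

Lemma K_min_max_lt (a a2 b b2 : R) : strip a a2 -> strip b b2 -> a < b -> b2 < a2 ->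
  K (Rmin a b) (Rmin a2 b2) + K (Rmax a b) (Rmax a2 b2) < K a a2 + K b b2.
Proof.
  unfold strip. intros. rewrite Rmin_left, Rmin_right, Rmax_right, Rmax_left by lra.
  apply K_Monge; lra.
Qed.

Lemma K_min_max_le (a a2 b b2 : R) : strip a a2 -> strip b b2 ->
  K (Rmin a b) (Rmin a2 b2) + K (Rmax a b) (Rmax a2 b2) <= K a a2 + K b b2.
Proof.
  intros H1 H2.
  destruct (Rtotal_order a b) as [h|[h|h]]; destruct (Rtotal_order a2 b2) as [h'|[h'|h']];
    try (apply Rlt_le; now apply K_min_max_lt);
    try (rewrite (Rmin_comm a), (Rmin_comm a2), (Rmax_comm a), (Rmax_comm a2), (Rplus_comm (K a a2));
         apply Rlt_le; now apply K_min_max_lt);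
    unfold Rmin, Rmax; repeat destruct Rle_dec; subst; lra.
Qed.

Definition min_path (u v : nat -> R) (i : nat) : R := Rmin (u i) (v i).
Definition max_path (u v : nat -> R) (i : nat) : R := Rmax (u i) (v i).

Lemma path_min_max (n : nat) (u v : nat -> R) : path n u -> path n v ->
  path n (min_path u v) /\ path n (max_path u v).
Proof.
  intros Hu Hv. split; intros i Hi; now apply strip_min_max; [apply Hu|apply Hv].
Qed.

Lemma cost_min_max_le (n : nat) (u v : nat -> R) : path n u -> path n v ->
  cost n (min_path u v) + cost n (max_path u v) <= cost n u + cost n v.
Proof.
  intros Hu Hv. induction n as [|n IH]; simpl; [lra|].
  assert (H := K_min_max_le _ _ _ _ (Hu n ltac:(lia)) (Hv n ltac:(lia))).
  assert (H2 := IH (fun i Hi => Hu i ltac:(lia)) (fun i Hi => Hv i ltac:(lia))).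
  unfold min_path, max_path in *. lra.
Qed.

Lemma cost_min_max_lt (n i : nat) (u v : nat -> R) : path n u -> path n v ->
  (i < n)%nat -> u i < v i -> v (S i) < u (S i) ->
  cost n (min_path u v) + cost n (max_path u v) < cost n u + cost n v.
Proof.
  intros Hu Hv Hi H1 H2. induction n as [|n IH]; simpl; [lia|].
  assert (Hu' : path n u) by (intros k Hk; apply Hu; lia).
  assert (Hv' : path n v) by (intros k Hk; apply Hv; lia).
  destruct (Nat.eq_dec i n) as [->|E].
  - assert (H := K_min_max_lt _ _ _ _ (Hu n ltac:(lia)) (Hv n ltac:(lia)) H1 H2).
    assert (H3 := cost_min_max_le n u v Hu' Hv'). unfold min_path, max_path in *. lra.
  - assert (H := K_min_max_le _ _ _ _ (Hu n ltac:(lia)) (Hv n ltac:(lia))).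
    assert (H3 := IH Hu' Hv' ltac:(lia)). unfold min_path, max_path in *. lra.
Qed.

(** Taking the last crossing ensures that the minimum follows [v] at all later indices, in
    particular at the neighbour after a touching point. *)
Lemma last_crossing (n : nat) (u v : nat -> R) : u O < v O -> v n < u n ->
  exists i, (i < n)%nat /\ u i < v i /\ forall j, (i < j <= n)%nat -> v j <= u j.
Proof.
  intros H0 Hn.
  assert (H : forall k, (k <= n)%nat -> (forall j, (k < j <= n)%nat -> v j <= u j) ->
    exists i, (i < n)%nat /\ u i < v i /\ forall j, (i < j <= n)%nat -> v j <= u j).
  { induction k as [|k IH]; intros Hk Hj.
    - exists O. destruct n; [lra|]. repeat split; auto; lia.
    - destruct (Rlt_le_dec (u (S k)) (v (S k))) as [h|h].
      + exists (S k). repeat split; auto.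
        destruct (Nat.eq_dec (S k) n) as [E|E]; [|lia]. rewrite E in h. lra.
      + apply IH; [lia|]. intros j Hkj. destruct (Nat.eq_dec j (S k)) as [->|E]; [exact h|].
        apply Hj. lia. }
  apply (H n); [lia|]. intros j Hj. lia.
Qed.

(** Two paths that cross can be exchanged at the crossing with a gain; when they
    only touch, the gain comes from moving the touching point, by the twist condition. *)
Lemma crossing_gain (n : nat) (u v : nat -> R) : path n u -> path n v ->
  u O < v O -> v n < u n ->
  (forall i, (i < n)%nat -> v i < v (S i)) ->
  (forall i m, (S i < n)%nat -> strip (v i) m -> strip m (v (S (S i))) ->
     K (v i) (v (S i)) + K (v (S i)) (v (S (S i))) <= K (v i) m + K m (v (S (S i)))) ->
  exists z y, path n z /\ path n y /\ z O = v O /\ z n = u n /\ y O = u O /\ y n = v n /\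
    cost n z + cost n y < cost n u + cost n v.
Proof.
  intros Hu Hv H0 Hn Hinc Hmin.
  destruct (path_min_max n u v Hu Hv) as [Hpmin Hpmax].
  destruct (last_crossing n u v H0 Hn) as (i & Hi & Hlt & Hge).
  assert (Eb : max_path u v O = v O /\ max_path u v n = u n /\ min_path u v O = u O /\ min_path u v n = v n).
  { unfold min_path, max_path. rewrite Rmax_right, Rmax_left, Rmin_left, Rmin_right by lra. auto. }
  destruct Eb as (E1 & E2 & E3 & E4).
  destruct (Hge (S i) ltac:(lia)) as [h|h].
  - exists (max_path u v), (min_path u v).
    refine (conj Hpmax (conj Hpmin (conj E1 (conj E2 (conj E3 (conj E4 _)))))).
    assert (H := cost_min_max_lt n i u v Hu Hv Hi Hlt h). lra.
  (* The paths touch at [S i]. The minimum comes there from [u i] and leaves along [v], while the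
     point is optimal between the neighbours [v i] and [v (S (S i))]; as [u i < v i], the twist
     moves it with a gain. *)
  - assert (HSi : (S i < n)%nat).
    { destruct (Nat.eq_dec (S i) n) as [E|E]; [rewrite E in h; lra|lia]. }
    assert (Ei : min_path u v i = u i) by (unfold min_path; rewrite Rmin_left; lra).
    assert (ESi : min_path u v (S i) = v (S i)) by (unfold min_path; rewrite Rmin_right; lra).
    assert (ESSi : min_path u v (S (S i)) = v (S (S i))).
    { unfold min_path. rewrite Rmin_right; [reflexivity|]. apply Hge. lia. }
    destruct (K_twist_strip (u i) (v i) (v (S i)) (v (S (S i)))) as (m & M1 & M2 & M3); auto.
    { rewrite <- Ei, <- ESi. apply Hpmin. lia. }
    exists (max_path u v), (update (min_path u v) (S i) m).
    assert (Hpath : path n (update (min_path u v) (S i) m)).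
    { apply path_update; auto; [now rewrite Ei|now rewrite ESSi]. }
    refine (conj Hpmax (conj Hpath (conj E1 (conj E2 (conj _ (conj _ _)))))).
    + now rewrite update_neq by lia.
    + now rewrite update_neq by lia.
    + rewrite cost_update by lia. rewrite Ei, ESi, ESSi.
      assert (H := cost_min_max_le n u v Hu Hv). lra.
Qed.

(** * Local properties of minimal polygons and the comparison of their costs *)

(** A zero step followed by a nonzero one could be improved by moving the doubled point into the
    latter, by [K_insert]. So after one zero step all steps vanish, which contradicts the gain of
    [2 PI p] per round. *)
Lemma minimal_circumscribed_increasing (p n k : nat) (th : nat -> R) : (1 <= p)%nat -> (2 <= n)%nat ->
  circumscribed p n th -> minimal p n th -> th k < th (S k).
Proof.
  intros Hp Hn Hc [_ Hmin]. assert (HPI := PI_RGT_0).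
  apply Rnot_le_lt. intros Hle.
  assert (Heq : forall i, th (S i) = th i \/ th i < th (S i)).
  { intros i. destruct Hc as [_ H]. specialize (H i). lra. }
  assert (Hall : forall i, th (S (k + i)) = th (k + i)%nat).
  { induction i as [|i IH].
    - rewrite Nat.add_0_r. destruct (Heq k); lra.
    - destruct (Heq (k + S i)%nat) as [h|h]; [exact h|exfalso].
      replace (k + S i)%nat with (S (k + i)) in h by lia.
      set (j := (k + i)%nat) in *.
      assert (Hcp := circumscribed_closed_path p n j th Hc).
      set (u := fun i => th (i + j)%nat) in Hcp.
      assert (U0 : u O = th j) by reflexivity.
      assert (U1 : u 1%nat = th (S j)) by reflexivity.
      assert (U2 : u 2%nat = th (S (S j))) by reflexivity.
      set (m := (th j + th (S (S j))) / 2).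
      assert (Hs : strip (th (S j)) (th (S (S j)))).
      { destruct Hc as [_ H]. specialize (H (S j)). unfold strip. lra. }
      unfold strip in Hs.
      assert (Hv : closed_path p n (update u 1 m)).
      { split.
        - apply path_update; [apply Hcp| |]; rewrite ?U0, ?U2; unfold strip, m; lra.
        - rewrite !update_neq by lia. apply Hcp. }
      specialize (Hmin _ Hv). rewrite <- (cost_shift p n j th Hc) in Hmin. fold u in Hmin.
      rewrite cost_update in Hmin by lia. rewrite U0, U1, U2, IH, K_diag in Hmin.
      assert (H := K_insert (th j) m (th (S (S j)))). unfold m in *. lra. }
  assert (Hconst : forall i, th (k + i)%nat = th k).
  { induction i as [|i IH]; [f_equal; lia|]. rewrite Nat.add_succ_r, Hall. exact IH. }
  destruct Hc as [Hc _]. specialize (Hc k). rewrite Hconst in Hc.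
  assert (1 <= INR p) by (apply (le_INR 1); exact Hp). nra.
Qed.

Lemma minimal_interior (p n i k : nat) (th : nat -> R) (m : R) : circumscribed p n th -> minimal p n th ->
  (S i < n)%nat -> strip (th (i + k)%nat) m -> strip m (th (S (S (i + k)))) ->
  K (th (i + k)%nat) (th (S (i + k))) + K (th (S (i + k))) (th (S (S (i + k))))
    <= K (th (i + k)%nat) m + K m (th (S (S (i + k)))).
Proof.
  intros Hc [_ Hmin] Hi H1 H2.
  assert (Hcp := circumscribed_closed_path p n k th Hc).
  set (u := fun i => th (i + k)%nat) in Hcp.
  assert (Hv : closed_path p n (update u (S i) m)).
  { split.
    - apply path_update; [apply Hcp|exact H1|exact H2].
    - rewrite !update_neq by lia. apply Hcp. }
  specialize (Hmin _ Hv). rewrite <- (cost_shift p n k th Hc) in Hmin. fold u in Hmin.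
  rewrite cost_update in Hmin by lia. unfold u in Hmin. simpl in Hmin. lra.
Qed.

Lemma minimal_ext (p n : nat) (u v : nat -> R) :
  (forall i, (i <= n)%nat -> u i = v i) -> minimal p n u -> minimal p n v.
Proof.
  intros E [[H1 H2] Hm]. split.
  - split; [now apply (path_ext n u)|]. rewrite <- !E by lia. exact H2.
  - intros w' Hw. rewrite <- (cost_ext n u v E). now apply Hm.
Qed.

Lemma circumscribed_crosses (p n : nat) (th : nat -> R) (x : R) : (1 <= p)%nat ->
  circumscribed p n th -> th O <= x -> exists k, th k <= x < th (S k).
Proof.
  intros Hp [Hper _] H0. assert (HPI := PI_RGT_0).
  apply NNPP. intros Hno.
  assert (H : forall k, th k <= x).
  { induction k as [|k IH]; [exact H0|]. apply Rnot_lt_le. intros Hc. apply Hno. now exists k. }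
  assert (Hm : forall m, th (m * n)%nat = th O + 2 * PI * INR p * INR m).
  { induction m as [|m IH]; [simpl; ring|].
    replace (S m * n)%nat with (m * n + n)%nat by lia. rewrite Hper, IH, S_INR. ring. }
  destruct (INR_archimed (2 * PI) (x - th O)) as (m & Hx); [lra|].
  specialize (H (m * n)%nat). rewrite Hm in H.
  assert (1 <= INR p) by (apply (le_INR 1); exact Hp).
  assert (0 <= INR m) by apply pos_INR.
  assert (INR m * (2 * PI) <= 2 * PI * INR p * INR m) by nra. lra.
Qed.

Lemma minimal_cost_convex (p n : nat) (x y z : nat -> R) : (1 <= p)%nat -> (1 <= n)%nat ->
  minimal p n x -> minimal p (S n) z -> minimal p (S (S n)) y ->
  2 * cost (S n) z < cost n x + cost (S (S n)) y.
Proof.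
  intros Hp Hn [Hx _] [_ Hz] Hy. assert (HPI := PI_RGT_0).
  assert (Hp1 : 1 <= INR p) by (apply (le_INR 1); exact Hp).
  set (th := periodic_extension p (S (S n)) y).
  assert (Hth : circumscribed p (S (S n)) th) by (apply periodic_extension_circumscribed; [lia|apply Hy]).
  assert (Eth : forall i, (i <= S (S n))%nat -> th i = y i).
  { intros i Hi. apply periodic_extension_eq; [lia|apply Hy|exact Hi]. }
  assert (Hmth : minimal p (S (S n)) th) by (apply (minimal_ext _ _ y); [intros; symmetry; now apply Eth|exact Hy]).
  rewrite <- (cost_ext (S (S n)) th y Eth).
  (* Puts the start of [x] at or after [th 0], since the search for [k] only goes forward. *)
  destruct (two_PI_translate (th O) (x O)) as (j & Hj).
  set (u := fun i => x i + 2 * PI * IZR j).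
  assert (Hu : closed_path p n u) by (now apply closed_path_translate).
  rewrite <- (cost_translate n j x). fold u.
  destruct (circumscribed_crosses p (S (S n)) th (u O)) as (k & Hk); [exact Hp|exact Hth|unfold u; lra|].
  rewrite <- (cost_shift p (S (S n)) k th Hth).
  assert (Hinc : forall i, th i < th (S i)).
  { intros i. apply (minimal_circumscribed_increasing p (S (S n))); auto. lia. }
  assert (Hcv := circumscribed_closed_path p (S (S n)) k th Hth).
  set (t := fun i => th (i + k)%nat) in *.
  (* Dropping the first and the last of the [n + 2] steps of [t] leaves [n] steps, as many as [u]
     has. At the start [u] is below [t 1]; at the end it is at least [t (n + 2)], which exceeds
     [t (n + 1)]. *)
  set (v := fun i => t (S i)).
  assert (Hlast : t (S (S n)) = t O + 2 * PI * INR p) by apply Hcv.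
  destruct (crossing_gain n u v) as (z1 & y1 & Pz & Py & Z0 & Zn & Y0 & Yn & Hgain).
  - apply Hu.
  - intros i Hi. apply Hcv. lia.
  - exact (proj2 Hk).
  - rewrite (proj2 Hu). unfold v. assert (A := Hinc (S n + k)%nat).
    change (th (S (S n + k))) with (t (S (S n))) in A. change (th (S n + k)%nat) with (t (S n)) in A.
    assert (B := proj1 Hk). change (th k) with (t O) in B. lra.
  - intros i _. apply Hinc.
  - intros i m Hi S1 S2. apply (minimal_interior p (S (S n)) (S i) k th m); auto. lia.
  (* The two dropped steps are restored, one to each new path: [W] appends the last, [Z] prepends
     the first, so that both have [n + 1] steps. *)
  - set (W := fun i => if Nat.leb i n then y1 i else t (S (S n))).
    set (Z := fun i => match i with O => t O | S i => z1 i end).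
    assert (HW : forall i, (i <= n)%nat -> W i = y1 i).
    { intros i Hi. unfold W. now rewrite (proj2 (Nat.leb_le i n) Hi). }
    assert (HWS : W (S n) = t (S (S n))).
    { unfold W. now rewrite (proj2 (Nat.leb_gt (S n) n) ltac:(lia)). }
    assert (PW : path (S n) W).
    { intros i Hi. destruct (Nat.eq_dec i n) as [->|E].
      - rewrite HW, HWS by lia. rewrite Yn. apply Hcv. lia.
      - rewrite !HW by lia. apply Py. lia. }
    assert (PZ : path (S n) Z).
    { intros [|i] Hi; simpl; [rewrite Z0; apply Hcv; lia|apply Pz; lia]. }
    assert (CW : cost (S n) W = cost n y1 + K (t (S n)) (t (S (S n)))).
    { simpl. rewrite HWS, HW by lia. rewrite (cost_ext n W y1 HW). now rewrite Yn. }
    assert (CZ : cost (S n) Z = K (t O) (t 1%nat) + cost n z1).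
    { rewrite cost_S_l. unfold Z at 1 2. rewrite Z0. reflexivity. }
    assert (Ct : cost (S (S n)) t = K (t O) (t 1%nat) + (cost n v + K (t (S n)) (t (S (S n))))).
    { rewrite cost_S_l. reflexivity. }
    (* [Z] leads from [t 0] to [u 0 + 2 PI p], [W] from [u 0] to [t 0 + 2 PI p]. Since [t 0 <= u 0],
       the minimum closes up from [t 0] and the maximum from [u 0]. The strict gain is already made,
       so the weak exchange suffices. *)
    destruct (path_min_max (S n) Z W PZ PW) as [Pmin Pmax].
    assert (HZn : Z (S n) = u O + 2 * PI * INR p).
    { unfold Z. rewrite Zn. apply Hu. }
    assert (HW0 : W O = u O) by (rewrite HW by lia; exact Y0).
    assert (HZ0 : Z O <= u O) by apply Hk.
    change (Z O) with (t O) in HZ0.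
    assert (Cmin : closed_path p (S n) (min_path Z W)).
    { split; [exact Pmin|]. unfold min_path. rewrite HZn, HWS, HW0, Hlast.
      change (Z O) with (t O). rewrite Rmin_right, Rmin_left by lra. ring. }
    assert (Cmax : closed_path p (S n) (max_path Z W)).
    { split; [exact Pmax|]. unfold max_path. rewrite HZn, HWS, HW0, Hlast.
      change (Z O) with (t O). rewrite Rmax_left, Rmax_right by lra. ring. }
    assert (M1 := Hz _ Cmin). assert (M2 := Hz _ Cmax).
    assert (M3 := cost_min_max_le (S n) Z W PZ PW). lra.
Qed.

(** * The area of a circumscribed polygon *)

Context (c : R -> plane) (gamma_eq : forall t, gamma c t = (X t, Y t)).

Lemma circle_point_eq (x s : R) :
  circle_point c r x s = (Ox x + r * sin (x + s), Oy x - r * cos (x + s)).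
Proof. unfold circle_point, center. rewrite gamma_eq. reflexivity. Qed.

Lemma on_circle_eq (y : R) (P : plane) :
  on_circle c r y P <-> (fst P - Ox y) ^ 2 + (snd P - Oy y) ^ 2 - r ^ 2 = 0.
Proof.
  unfold on_circle, center. rewrite gamma_eq. simpl fst. simpl snd.
  fold (Ox y) (Oy y). split; lra.
Qed.

Lemma first_hit_unique (x y : R) (P Q : plane) :
  first_hit c r x y P -> first_hit c r x y Q -> P = Q.
Proof.
  intros (s & Hs & -> & HP & Hs2) (t & Ht & -> & HQ & Ht2).
  destruct (Rtotal_order s t) as [h|[h|h]].
  - exfalso. apply (Ht2 s); auto.
  - now subst.
  - exfalso. apply (Hs2 t); auto.
Qed.

Lemma is_vertex_unique (x y : R) (P Q : plane) :
  is_vertex c r x y P -> is_vertex c r x y Q -> P = Q.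
Proof.
  assert (HPI := PI_RGT_0).
  intros [(E & ->)|[(E & ->)|(E & HP)]] [(F & ->)|[(F & ->)|(F & HQ)]]; try reflexivity; try lra.
  eapply first_hit_unique; eauto.
Qed.

Lemma vertex_eq (x y : R) (P : plane) : is_vertex c r x y P -> vertex c r x y = P.
Proof.
  intros H. apply (is_vertex_unique x y); [|exact H].
  apply (epsilon_spec (inhabits (0, 0)) (is_vertex c r x y)). now exists P.
Qed.

(** The turning angles [a] and [b] of [chord], extended to [y = x] and [y = x + 2 PI]. *)
Definition turning_angles (x y a b : R) : Prop :=
  (y = x /\ a = 0 /\ b = 0) \/ (y = x + 2 * PI /\ a = PI /\ b = PI) \/
  exists d, chord x y a b d.

Lemma turning_angles_exist (x y : R) : strip x y -> exists a b, turning_angles x y a b.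
Proof.
  intros Hs. unfold strip in Hs.
  destruct (Req_dec y x) as [E|E]; [exists 0, 0; now left|].
  destruct (Req_dec y (x + 2 * PI)) as [E'|E']; [exists PI, PI; right; now left|].
  destruct (chord_exists x y) as (a & b & d & H); [lra|].
  exists a, b. right; right. now exists d.
Qed.

Lemma turning_angles_bounds (x y a b : R) : turning_angles x y a b -> 0 <= a <= PI /\ 0 <= b <= PI.
Proof.
  assert (HPI := PI_RGT_0).
  intros [(_ & -> & ->)|[(_ & -> & ->)|(d & ? & ? & ? & ? & ? & _)]]; lra.
Qed.

Lemma turning_angles_unique (x y a b a' b' : R) :
  turning_angles x y a b -> turning_angles x y a' b' -> b = b'.
Proof.
  assert (HPI := PI_RGT_0).
  assert (Hc : forall a b d, chord x y a b d -> x < y < x + 2 * PI).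
  { intros a0 b0 d (? & ? & ? & ? & ? & ? & _). lra. }
  intros [(E & -> & ->)|[(E & -> & ->)|(d & H)]] [(F & -> & ->)|[(F & -> & ->)|(d' & H')]];
    try reflexivity; try (specialize (Hc _ _ _ H)); try (specialize (Hc _ _ _ H')); try lra.
  apply (power_zero _ _ _ _ _ b H'); [destruct H as (? & ? & ? & ? & ? & _); lra|].
  rewrite (power_on_circle _ _ _ _ _ b H). replace (b + d - b) with d by ring. ring.
Qed.

Lemma turning_angles_translate (k : Z) (x y a b : R) : turning_angles x y a b ->
  turning_angles (x + 2 * PI * IZR k) (y + 2 * PI * IZR k) a b.
Proof.
  intros [(-> & -> & ->)|[(-> & -> & ->)|(d & H)]].
  - now left.
  - right; left. repeat split; ring.
  - right; right. exists d. destruct H as (H1 & H2 & H3 & H4 & H5 & H6 & H7 & H8).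
    unfold chord. rewrite !(periodic_Z Ox Ox_periodic), !(periodic_Z Oy Oy_periodic).
    replace (x + 2 * PI * IZR k + a + d) with (x + a + d + 2 * PI * IZR k) by ring.
    rewrite cos_translate, sin_translate. repeat split; auto. lra.
Qed.

Lemma is_vertex_turning (x y a b : R) : turning_angles x y a b ->
  is_vertex c r x y (circle_point c r x a) /\ circle_point c r x a = circle_point c r y (- b).
Proof.
  assert (HPI := PI_RGT_0). assert (Hr := r_pos).
  intros [(-> & -> & ->)|[(-> & -> & ->)|(d & H)]].
  - split; [left|f_equal; ring]. split; [reflexivity|].
    rewrite circle_point_eq, gamma_eq, Rplus_0_r. unfold Ox, Oy. f_equal; ring.
  - split; [right; left; auto|].
    rewrite !circle_point_eq, Ox_periodic, Oy_periodic.
    replace (x + 2 * PI + - PI) with (x + PI) by ring. reflexivity.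
  - destruct (chord_vertex _ _ _ _ _ H) as (E1 & E2).
    assert (E : circle_point c r x a = circle_point c r y (- b)).
    { rewrite !circle_point_eq. replace (y + - b) with (y - b) by ring. now rewrite E1, E2. }
    split; [|exact E]. right; right.
    destruct (chord_sin_pos _ _ _ _ _ H) as (H1 & H2). assert (H0 := H).
    destruct H as (Ha & Hb & Hd & Had & Hbd & Hy & Hu & Hv).
    split; [lra|]. exists a. split; [lra|]. split; [reflexivity|]. split.
    + rewrite on_circle_eq, E, circle_point_eq. simpl fst. simpl snd.
      assert (Q := sin2_cos2_pow (y + - b)).
      transitivity (r ^ 2 * (sin (y + - b) ^ 2 + cos (y + - b) ^ 2 - 1)); [ring|rewrite Q; ring].
    + intros s Hs. rewrite on_circle_eq, circle_point_eq. simpl fst. simpl snd.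
      assert (Q := sin2_cos2_pow (x + a + d)). assert (Q2 := sin2_cos2_pow (x + s)).
      replace (Ox x + r * sin (x + s) - Ox y) with ((Ox x - Ox y) + r * sin (x + s)) by ring.
      replace (Oy x - r * cos (x + s) - Oy y) with ((Oy x - Oy y) - r * cos (x + s)) by ring.
      rewrite Hu, Hv.
      (* Mirror image of [power_on_circle]: before the angle [a] the points of the circle at [x] are
         inside the circle at [y], so there is no earlier hit. *)
      assert (P : (2 * r * sin d * cos (x + a + d) + r * sin (x + s)) ^ 2
         + (2 * r * sin d * sin (x + a + d) - r * cos (x + s)) ^ 2 - r ^ 2
         = 4 * r ^ 2 * sin d * (sin d - sin (a + d - s))).
      { replace (a + d - s) with ((x + a + d) - (x + s)) by ring.
        rewrite (sin_minus (x + a + d)).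
        set (p := x + a + d) in *. set (z := x + s) in *.
        transitivity (r ^ 2 * (sin z ^ 2 + cos z ^ 2) + 4 * r ^ 2 * sin d ^ 2 * (sin p ^ 2 + cos p ^ 2)
          - 4 * r ^ 2 * sin d * (sin p * cos z - cos p * sin z) - r ^ 2); [ring|].
        rewrite Q, Q2. ring. }
      rewrite P. assert (L : sin d < sin (a + d - s)) by (apply sin_lt_sin; lra).
      assert (0 < 4 * r ^ 2 * sin d).
      { apply Rmult_lt_0_compat; [|exact H1]. assert (0 < r ^ 2) by (apply pow_lt; lra). lra. }
      nra.
Qed.

(** * The area integral regrouped by vertices *)

(** An antiderivative in [s] of half of [u dv - v du] along the circle at [x]. *)
Definition arc_area (x s : R) : R :=
  / 2 * (r ^ 2 * s - r * (Ox x * cos (x + s) + Oy x * sin (x + s))).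

(** The left side collects the end of one side and the start of the next, both at the vertex between
    them. The terms [r ^ 2 / 2 * (y - x)] telescope to [PI r ^ 2 p] around the polygon. *)
Lemma arc_area_turning (x y a b : R) : turning_angles x y a b ->
  arc_area x a - arc_area y (- b) = r ^ 2 / 2 * (y - x) + K x y.
Proof.
  intros [(-> & -> & ->)|[(-> & -> & ->)|(d & H)]].
  - rewrite K_diag. replace (- 0) with 0 by ring. ring.
  - rewrite K_full. unfold arc_area. rewrite Ox_periodic, Oy_periodic.
    replace (x + 2 * PI + - PI) with (x + PI) by ring. field.
  - rewrite (proj1 (K_chord _ _ _ _ _ H)). unfold arc_area.
    destruct H as (Ha & Hb & Hd & Had & Hbd & Hy & Hu & Hv).
    replace (y + - b) with ((x + a + d) + d) by lra.
    assert (Ex : x + a = (x + a + d) - d) by ring.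
    set (p := x + a + d) in *. rewrite Ex.
    replace (Ox x) with (Ox y + 2 * r * sin d * cos p) by lra.
    replace (Oy x) with (Oy y + 2 * r * sin d * sin p) by lra.
    replace (- b) with (a + 2 * d - (y - x)) by lra.
    rewrite cos_plus, cos_minus, sin_plus, sin_minus.
    assert (Q := sin2_cos2_pow p).
    apply Rminus_diag_uniq.
    match goal with |- ?L = 0 =>
      transitivity (r ^ 2 * sin d * cos d * (1 - (sin p ^ 2 + cos p ^ 2))) end; [field|].
    rewrite Q. ring.
Qed.

Lemma angle_eq (u v : R) : sin u = sin v -> cos u = cos v -> - (2 * PI) < u - v < 2 * PI -> u = v.
Proof.
  intros Hs Hc Hb.
  assert (Q := sin2_cos2_pow v).
  assert (E : cos (2 * ((u - v) / 2)) = 1).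
  { replace (2 * ((u - v) / 2)) with (u - v) by field. rewrite cos_minus, Hs, Hc. lra. }
  rewrite cos_2a_sin in E.
  assert (E0 : sin ((u - v) / 2) = 0) by nra.
  destruct (Rtotal_order u v) as [h|[h|h]]; [exfalso|exact h|exfalso].
  - assert (0 < sin (- ((u - v) / 2))) by (apply sin_gt_0; lra). rewrite sin_neg in H. lra.
  - assert (0 < sin ((u - v) / 2)) by (apply sin_gt_0; lra). lra.
Qed.

Lemma circle_point_inj (x s t : R) : - (2 * PI) < s - t < 2 * PI ->
  circle_point c r x s = circle_point c r x t -> s = t.
Proof.
  intros Hst. rewrite !circle_point_eq. intros E. injection E as E1 E2.
  assert (Hr := r_pos).
  assert (S1 : sin (x + s) = sin (x + t)) by (apply Rmult_eq_reg_l with r; lra).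
  assert (S2 : cos (x + s) = cos (x + t)) by (apply Rmult_eq_reg_l with r; lra).
  assert (x + s = x + t) by (apply angle_eq; lra). lra.
Qed.

(** The arc chosen by [epsilon] is determined because the parameters allowed for each endpoint fill
    less than a full turn. *)
Lemma side_eq (th : nat -> R) (i : nat) (a b a' b' : R) :
  turning_angles (th i) (th (S i)) a b -> turning_angles (th (S i)) (th (S (S i))) a' b' ->
  side c r th (S i) = (- b, a').
Proof.
  intros H H'. assert (HPI := PI_RGT_0).
  destruct (is_vertex_turning _ _ _ _ H) as (V & E).
  destruct (is_vertex_turning _ _ _ _ H') as (V' & E').
  assert (B := turning_angles_bounds _ _ _ _ H). assert (B' := turning_angles_bounds _ _ _ _ H').
  set (P := is_arc c r (th (S i)) (vertex c r (th (pred (S i))) (th (S i)))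
     (vertex c r (th (S i)) (th (S (S i))))).
  assert (HP : P (- b, a')).
  { unfold P, is_arc. simpl pred. rewrite (vertex_eq _ _ _ V), (vertex_eq _ _ _ V').
    simpl fst. simpl snd. repeat split; try lra. now symmetry. }
  assert (HE : P (side c r th (S i))).
  { apply (epsilon_spec (inhabits (0, 0)) P). eexists; exact HP. }
  destruct (side c r th (S i)) as [u v]. unfold P, is_arc in HP, HE. simpl fst in *. simpl snd in *.
  destruct HP as (P1 & P2 & P3 & P4). destruct HE as (Q1 & Q2 & Q3 & Q4).
  f_equal; apply (circle_point_inj (th (S i))); try lra; congruence.
Qed.

Lemma area_integral_circle (x s t : R) :
  area_integral (circle_point c r x) s t = arc_area x t - arc_area x s.
Proof.
  unfold area_integral.
  rewrite (RInt_ext _ (fun z => r ^ 2 + r * (Ox x * sin (x + z) - Oy x * cos (x + z)))).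
  2: { intros z _. unfold xcoord, ycoord.
    rewrite (Derive_ext (fun t => snd (circle_point c r x t)) (fun t => Oy x - r * cos (x + t)))
      by (intros; now rewrite circle_point_eq).
    rewrite (Derive_ext (fun t => fst (circle_point c r x t)) (fun t => Ox x + r * sin (x + t)))
      by (intros; now rewrite circle_point_eq).
    rewrite circle_point_eq. simpl fst. simpl snd.
    replace (Derive (fun t => Oy x - r * cos (x + t)) z) with (r * sin (x + z)).
    2: { symmetry. apply is_derive_unique. auto_derive; [trivial|ring]. }
    replace (Derive (fun t => Ox x + r * sin (x + t)) z) with (r * cos (x + z)).
    2: { symmetry. apply is_derive_unique. auto_derive; [trivial|ring]. }
    assert (Q := sin2_cos2_pow (x + z)).
    match goal with |- ?a = ?b => change (@eq R a b) end.
    transitivity (r ^ 2 * (sin (x + z) ^ 2 + cos (x + z) ^ 2)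
      + r * (Ox x * sin (x + z) - Oy x * cos (x + z))); [ring|rewrite Q; ring]. }
  rewrite (is_RInt_unique _ _ _ (minus (2 * arc_area x t) (2 * arc_area x s))).
  - unfold minus, plus, opp; simpl. field.
  - apply (is_RInt_derive (fun z => 2 * arc_area x z)).
    + intros z _. unfold arc_area. auto_derive; [trivial|]. field.
    + intros z _. apply (ex_derive_continuous (V := R_NormedModule)). auto_derive. trivial.
Qed.

Lemma polygon_area_eq (p q : nat) (th : nat -> R) : circumscribed p q th ->
  polygon_area c r q th = PI * r ^ 2 * INR p + cost q th.
Proof.
  intros Hth.
  assert (Hang : forall i, exists ab : R * R, turning_angles (th i) (th (S i)) (fst ab) (snd ab)).
  { intros i. destruct (turning_angles_exist (th i) (th (S i))) as (a & b & H).
    - destruct Hth as [_ H]. specialize (H i). unfold strip. lra.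
    - now exists (a, b). }
  apply functional_choice in Hang. destruct Hang as (ab & Hab).
  (* Summing by vertices leaves the halves at the first and at the last vertex unpaired. *)
  assert (Hsum : forall n, sum_n_m (fun i => area_integral (circle_point c r (th i))
      (fst (side c r th i)) (snd (side c r th i))) 1 n =
    r ^ 2 / 2 * (th (S n) - th 1%nat) + cost n (fun i => th (S i))
    + arc_area (th (S n)) (- snd (ab n)) - arc_area (th 1%nat) (- snd (ab O))).
  { induction n as [|n IH].
    - rewrite sum_n_m_zero by lia. unfold zero; simpl. ring.
    - rewrite sum_n_Sm by lia. rewrite IH. unfold plus; simpl.
      rewrite (side_eq th n _ _ _ _ (Hab n) (Hab (S n))). simpl fst. simpl snd.
      rewrite area_integral_circle.
      assert (E := arc_area_turning _ _ _ _ (Hab (S n))). simpl in *. lra. }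
  unfold polygon_area. rewrite Hsum.
  assert (E1 : th (S q) = th 1%nat + 2 * PI * INR p) by (rewrite <- (proj1 Hth); f_equal; lia).
  assert (E0 : th q = th O + 2 * PI * INR p) by (rewrite <- (proj1 Hth); reflexivity).
  (* The angles were chosen separately at each index, so their periodicity rests on uniqueness. It
     makes the two unpaired halves cancel. *)
  assert (Eb : snd (ab q) = snd (ab O)).
  { apply (turning_angles_unique (th q) (th (S q)) (fst (ab q)) _ (fst (ab O))); [apply Hab|].
    rewrite E0, E1, INR_IZR_INZ. apply turning_angles_translate, Hab. }
  assert (Ec : cost q (fun i => th (S i)) = cost q th).
  { rewrite <- (cost_shift p q 1 th Hth). apply cost_ext. intros; f_equal; lia. }
  assert (Ea : arc_area (th (S q)) (- snd (ab q)) = arc_area (th 1%nat) (- snd (ab O))).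
  { rewrite Eb, E1, INR_IZR_INZ. unfold arc_area.
    rewrite (periodic_Z Ox Ox_periodic), (periodic_Z Oy Oy_periodic).
    replace (th 1%nat + 2 * PI * IZR (Z.of_nat p) + - snd (ab O))
      with (th 1%nat + - snd (ab O) + 2 * PI * IZR (Z.of_nat p)) by ring.
    now rewrite cos_translate, sin_translate. }
  rewrite Ea, Ec, E1. field.
Qed.

Lemma is_minimal_area_of_minimal (p q : nat) (u : nat -> R) : (0 < q)%nat -> minimal p q u ->
  is_minimal_area c r p q (PI * r ^ 2 * INR p + cost q u).
Proof.
  intros Hq [Hu Hmin]. assert (Hth := periodic_extension_circumscribed p q u Hq Hu).
  split.
  - exists (periodic_extension p q u). split; [exact Hth|].
    rewrite (polygon_area_eq p q _ Hth). f_equal. apply cost_ext.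
    intros i Hi. now apply periodic_extension_eq.
  - intros th Hc. rewrite (polygon_area_eq p q th Hc).
    assert (H := circumscribed_closed_path p q 0 th Hc).
    specialize (Hmin _ H). rewrite (cost_shift p q 0 th Hc) in Hmin. lra.
Qed.

Lemma minimal_of_is_minimal_area (p q : nat) (v : R) : (0 < q)%nat -> is_minimal_area c r p q v ->
  exists u, minimal p q u /\ v = PI * r ^ 2 * INR p + cost q u.
Proof.
  intros Hq ((th & Hth & E) & Hmin). exists th.
  rewrite (polygon_area_eq p q th Hth) in E. split; [|lra]. split.
  - destruct (circumscribed_closed_path p q 0 th Hth) as [H1 H2].
    split.
    + apply (path_ext q (fun i => th (i + 0)%nat)); [intros; f_equal; lia|exact H1].
    + rewrite Nat.add_0_r in H2. exact H2.
  - intros w' Hw. assert (Hc := periodic_extension_circumscribed p q w' Hq Hw).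
    specialize (Hmin _ Hc). rewrite (polygon_area_eq p q _ Hc) in Hmin.
    rewrite (cost_ext q (periodic_extension p q w') w') in Hmin; [lra|].
    intros i Hi. now apply periodic_extension_eq.
Qed.

End Centers.

Theorem mainTheorem9 :
  forall (c : R -> plane) (T r : R),
    convex_curve c T ->
    (forall t : R, curvature_radius c t < r) ->
    exists N : nat -> nat -> R,
      (forall p q : nat, (1 <= p)%nat -> (p <= q)%nat ->
        is_minimal_area c r p q (N p q)) /\
      (forall p q : nat, (0 < p)%nat -> (0 < q)%nat -> Nat.gcd p q = 1%nat ->
        0 < INR p / INR q < 1 ->
        N p (q - 1)%nat + N p (q + 1)%nat > 2 * N p q).
Proof.
  intros c T r Hc Hrad.
  destruct (tangent_angle_parametrization c T r Hc Hrad) as (rho & Hlt & Hcv).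
  assert (Hgam : forall t, gamma c t = (fst (gamma c t), snd (gamma c t))).
  { intros t. apply surjective_pairing. }
  set (X := fun t => fst (gamma c t)) in *. set (Y := fun t => snd (gamma c t)) in *.
  exists (fun p q => epsilon (inhabits 0) (is_minimal_area c r p q)).
  assert (HN : forall p q : nat, (1 <= p)%nat -> (p <= q)%nat ->
    is_minimal_area c r p q (epsilon (inhabits 0) (is_minimal_area c r p q))).
  { intros p q Hp Hq. apply (epsilon_spec (inhabits 0) (is_minimal_area c r p q)).
    destruct (minimal_exists r rho X Y Hcv Hlt p q Hp Hq) as (u & Hu).
    eexists. apply (is_minimal_area_of_minimal r rho X Y Hcv Hlt c Hgam p q u); [lia|exact Hu]. }
  split; [exact HN|].
  intros p q Hp Hq _ [_ Hpq].
  assert (Hlt' : (p < q)%nat).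
  { apply INR_lt. assert (0 < INR q) by (apply lt_0_INR; exact Hq).
    apply Rmult_lt_reg_r with (/ INR q); [now apply Rinv_0_lt_compat|].
    rewrite Rinv_r by lra. exact Hpq. }
  (* Writing [q = S n] avoids truncated subtraction, and [p < q] becomes [p <= n], so a minimal
     [n]-gon exists. *)
  destruct q as [|n]; [lia|].
  replace (S n - 1)%nat with n by lia. replace (S n + 1)%nat with (S (S n)) by lia.
  destruct (minimal_of_is_minimal_area r rho X Y Hcv Hlt c Hgam p n _ ltac:(lia)
    (HN p n ltac:(lia) ltac:(lia))) as (x & Hx & ->).
  destruct (minimal_of_is_minimal_area r rho X Y Hcv Hlt c Hgam p (S n) _ ltac:(lia)
    (HN p (S n) ltac:(lia) ltac:(lia))) as (z & Hz & ->).
  destruct (minimal_of_is_minimal_area r rho X Y Hcv Hlt c Hgam p (S (S n)) _ ltac:(lia)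
    (HN p (S (S n)) ltac:(lia) ltac:(lia))) as (y & Hy & ->).
  (* The constant [PI r ^ 2 p] is common to the three areas and drops out of the inequality. *)
  assert (H := minimal_cost_convex r rho X Y Hcv Hlt p n x y z ltac:(lia) ltac:(lia) Hx Hz Hy).
  lra.
Qed.
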